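(* Let $\xi,\xi_1,\xi_2,\ldots$ be independent identically distributed real random variables with finite mean ${\bf E}\xi>0$ and common distribution $F$. Let $\tau$ be a counting random variable with ${\bf E}\tau<\infty$, independent of the sequence $\{\xi_n\}$, whose distribution is intermediate regularly varying. If the distribution $F$ is long-tailed and dominated varying, then $$ {\bf P}\{S_\tau>x\}\sim{\bf P}\{M_\tau>x\}\sim{\bf E}\tau\,\overline F(x)+{\bf P}\{\tau>x/{\bf E}\xi\}\quad\text{as }x\to\infty . $$
   Context: $\overline F(x)={\bf P}\{\xi>x\}$, and $F$ is right-unbounded: $\overline F(x)>0$ for all $x$. $S_0=0$, $S_n=\xi_1+\cdots+\xi_n$, $M_n=\max_{0\le i\le n}S_i$. A counting random variable is a random variable with values in $\{0,1,2,\ldots\}$; $S_\tau$ and $M_\tau$ are $S_n$ and $M_n$ evaluated at the random index $n=\tau$. The notation $f(x)\sim g(x)$ means $f(x)/g(x)\to1$. A right-unbounded distribution $F$ is long-tailed if $\overline F(x+y)\sim\overline F(x)$ as $x\to\infty$ for any fixed $y$. It is dominated varying if there exists $c$ such that $\overline F(x)\le c\,\overline F(2x)$ for all $x$. A distribution $G$ with tail $\overline G(x)=G((x,\infty))>0$ for all $x$ is intermediate regularly varying (at infinity) if $\lim_{\varepsilon\downarrow0}\limsup_{x\to\infty}\overline G((1-\varepsilon)x)/\overline G(x)=1$. *)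

(* Defs.v *)
From HB Require Import structures.
From mathcomp Require Import all_boot all_order all_algebra finmap.
From mathcomp Require Import all_classical all_reals all_analysis.

Set Implicit Arguments.
Unset Strict Implicit.
Unset Printing Implicit Defensive.

Import Order.TTheory GRing.Theory Num.Theory.
Import numFieldNormedType.Exports.

Local Open Scope classical_set_scope.
Local Open Scope ring_scope.

(* Since x / 0 = 0, convergence to 1 forces g to be eventually nonzero. *)
Definition asymp_equiv (R : realType) (f g : R -> R) : Prop :=
  f x / g x @[x --> +oo] --> (1 : R).

Definition tail (R : realType) (G : probability R R)
    (x : R) : R :=
  fine (G `]x, +oo[%classic).

Definition right_unbounded (R : realType)
    (G : probability R R) : Prop :=
  forall x, 0 < tail G x.

Definition long_tailed (R : realType)
    (G : probability R R) : Prop :=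
  right_unbounded G /\
  forall y, asymp_equiv (fun x => tail G (x + y)) (tail G).

Definition dominated_varying (R : realType)
    (G : probability R R) : Prop :=
  right_unbounded G /\
  exists c, forall x, tail G x <= c * tail G (2 * x).

Definition intermediate_regularly_varying (R : realType)
    (G : probability R R) : Prop :=
  right_unbounded G /\
  limf_esup (fun x : R => (tail G ((1 - e) * x) / tail G x)%:E) +oo%R
    @[e --> (0 : R)^'+] --> 1%E.

Definition mutually_independent d (T : measurableType d) (R : realType)
    (P : probability T R) (I : choiceType) (X : I -> {RV P >-> R}) : Prop :=
  forall (J : {fset I}) (B : I -> set R), (forall i, measurable (B i)) ->
  P (\bigcap_(i in [set` J]) (X i @^-1` B i)) =
  (\prod_(i <- J) P (X i @^-1` B i))%E.

(* The sigma-algebra generated by the whole family, not by its members one at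
   a time. *)
Definition sigma_family d (T : measurableType d) (R : realType)
    (P : probability T R) (I : Type) (X : I -> {RV P >-> R}) : set (set T) :=
  <<s \bigcup_i preimage_set_system setT (X i) measurable >>.

(* nat carries the discrete sigma-algebra, so A ranges over all subsets. *)
Definition independent_of_family d (T : measurableType d) (R : realType)
    (P : probability T R) (tau : {RV P >-> nat}) (I : Type)
    (X : I -> {RV P >-> R}) : Prop :=
  forall (A : set nat) (E : set T), sigma_family X E ->
  P (tau @^-1` A `&` E) = (P (tau @^-1` A) * P E)%E.

Section natr_rv.
Context d (T : measurableType d) (R : realType) (P : probability T R).

Definition natr_rv (tau : {RV P >-> nat}) (w : T) : R := (tau w)%:R.

Lemma measurable_natr_rv (tau : {RV P >-> nat}) :
  measurable_fun setT (natr_rv tau).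
Proof. exact: (measurableT_comp (f := fun n : nat => n%:R : R)). Qed.

HB.instance Definition _ (tau : {RV P >-> nat}) :=
  isMeasurableFun.Build _ _ _ _ (natr_rv tau) (measurable_natr_rv tau).

End natr_rv.

Definition partial_sum (T : Type) (R : realType) (xi : nat -> T -> R)
    (n : nat) (w : T) : R :=
  \sum_(1 <= i < n.+1) xi i w.

(* The unit of the iterated maximum is S_0, which is one of the terms. *)
Definition running_max (T : Type) (R : realType) (xi : nat -> T -> R)
    (n : nat) (w : T) : R :=
  \big[Num.max/partial_sum xi 0 w]_(0 <= i < n.+1) partial_sum xi i w.

(* Main.v *)
Require Import Defs.
From mathcomp Require Import all_boot all_order all_algebra finmap.
From mathcomp Require Import all_classical all_reals all_analysis.
From mathcomp Require Import measurable_realfun.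
From mathcomp Require Import ring lra zify.
Set Implicit Arguments.
Unset Strict Implicit.
Unset Printing Implicit Defensive.
Import Order.TTheory GRing.Theory Num.Theory.
Import numFieldNormedType.Exports.
Local Open Scope classical_set_scope.
Local Open Scope ring_scope.

(** Write [a] for the mean of a step and [tail F] for the tail of its law.
    The walk stopped at [tau] exceeds a high level [x] in one of two ways:
    either one of the steps is huge, which costs about [E tau * tail F x], or
    [tau] itself is so large that the drift carries the walk past [x], which
    costs about [P (tau > x / a)].

    Since [tau] is independent of the steps, the probabilities to estimate are
    integrals, under the law of [tau], of [n |-> P (S_n > x)] and
    [n |-> P (M_n > x)] ([prob_at_random_index]).  As [S_n <= M_n], it is
    enough to bound the first function from below and the second from above,
    and four regimes of [n] suffice.

    - For [n] bounded, both are asymptotic to [n * tail F x].  From below,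
      sum over the index of the single big step, the other steps being
      bounded ([partial_sum_fixed_lower]).  From above, either a step exceeds
      [x - n K], or one step exceeds [x / n] while another one exceeds [K],
      which is negligible by dominated variation
      ([running_max_fixed_upper]).
    - For [n <= (1 - e) x / a], [P (M_n > x) <= C n * tail F x] with [C]
      independent of [n] and [x] ([running_max_bound_below_drift]).  Against
      the law of [tau] restricted to large values this contributes a small
      multiple of [tail F x], because [tau] is integrable.
    - For [n > x / (a (1 - e))], [P (S_n > x)] is close to 1 by the weak law of
      large numbers ([partial_sum_lower_above_drift]).
    - In the upper bound, [P (M_n > x)] is bounded by 1 for
      [n > (1 - e) x / a].

    Intermediate regular variation says that [P (tau > (1 - e) x / a)] and
    [P (tau > x / (a (1 - e)))] are both close to [P (tau > x / a)] when [e] is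
    small ([irv_ratio]), and the bounds match.

    The crux is the uniform bound of the second regime, which must hold with
    nothing more than a first moment.  Subtract from each step a number [a']
    slightly above [a]: the walk then has negative drift and has to exceed a
    level [y] proportional to [x].  A step above [y] costs [n * tail F y].
    For the other steps, take the exponent [lam] with
    [expR (lam * y) = 1 / (n * tail F y)].  In the exponential moment of a step
    truncated at [y], the negative drift absorbs the contribution of the
    values below [1 / lam] ([exp_moment_le1]), and dominated variation bounds
    that of the values between [1 / lam] and [y] by
    [K * expR (lam * y) * tail F y = K / n] ([truncated_exp_moment]).  The
    maximal inequality for the exponential of the walk
    ([exponential_maximal_bound]) then gives
    [(1 + K / n) ^ n * expR (- lam * y) <= expR K * n * tail F y].
    The same two ingredients give the weak law of large numbers. *)
(** * Elementary inequalities *)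

(** Only [u <= 1] is required: the bound is applied to variables that are
    truncated above and may be very negative. *)
Lemma expR_le_quadratic (R : realType) (u : R) : u <= 1 ->
  expR u <= 1 + u + 2 * u ^+ 2.
Proof.
move=> u1; have [u0|u0] := leP u 0.
  have := expR_ge1Dx (- u); rewrite expRN => h.
  have e0 := expR_gt0 u.
  have : expR u * (1 - u) <= 1.
    by rewrite -ler_pdivlMl// mulr1.
  nra.
(* Halving the exponent keeps the bound 1 / (1 - u/2) ^ 2 finite at u = 1. *)
have := expR_ge1Dx (- (u / 2)); rewrite expRN => h.
have e0 := expR_gt0 (u / 2).
have h2 : expR (u / 2) * (1 - u / 2) <= 1 by rewrite -ler_pdivlMl// mulr1.
have -> : expR u = expR (u / 2) ^+ 2 by rewrite expr2 -expRD; congr expR; lra.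
set x := expR (u / 2) in e0 h2 *.
have v0 : 0 < 1 - u / 2 by lra.
have xv : x ^+ 2 * (1 - u / 2) ^+ 2 <= 1.
  by rewrite -exprMn expr_le1// mulr_ge0 ?ltW.
have : 1 <= (1 + u + 2 * u ^+ 2) * (1 - u / 2) ^+ 2.
  have -> : (1 + u + 2 * u ^+ 2) * (1 - u / 2) ^+ 2 =
    1 + u ^+ 2 * ((1 - u) * (5 / 4 - u / 2)) by field.
  rewrite lerDl mulr_ge0 ?sqr_ge0// mulr_ge0; lra.
move=> h1; rewrite -(ler_pM2r (exprn_gt0 2 v0)); exact: le_trans h1.
Qed.

Lemma exprn_le_expR (R : realType) (x : R) n : 0 <= x ->
  x ^+ n <= n`!%:R * expR x.
Proof.
move=> x0; have f0 : 0 < n`!%:R :> R by rewrite ltr0n fact_gt0.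
rewrite mulrC -ler_pdivrMr//; case: n f0 => [|n] f0.
  rewrite expr0 fact0 divr1 -[leLHS]addr0.
  by rewrite (le_trans _ (expR_ge1Dx x))// lerD2l.
by apply: le_trans (expR_ge1Dxn n x0); rewrite lerDr.
Qed.

Lemma bernoulli_le (R : realDomainType) (t : R) n : 0 <= t <= 1 ->
  1 - n%:R * t <= (1 - t) ^+ n.
Proof.
move=> /andP[t0 t1]; elim: n => [|n IH]; first by rewrite mul0r subr0 expr0.
rewrite exprS; apply: (@le_trans _ _ ((1 - t) * (1 - n%:R * t))).
  have : 0 <= n%:R * t * t by rewrite !mulr_ge0.
  rewrite -natr1; lra.
by rewrite ler_wpM2l// subr_ge0.
Qed.

Lemma sum_nat_le (R : numDomainType) n (f : nat -> R) c :
  (forall i, (0 < i <= n)%N -> f i <= c) ->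
  \sum_(1 <= i < n.+1) f i <= n%:R * c.
Proof.
move=> fc; apply: (@le_trans _ _ (\sum_(1 <= i < n.+1) c)).
  exact: ler_sum_nat.
by rewrite sumr_const_nat subSS subn0 -[_ *+ n]mulr_natl.
Qed.

(** * Events and their probabilities *)

Lemma measurable_set_lt d (T : measurableType d) (R : realType) (f g : T -> R) :
  measurable_fun setT f -> measurable_fun setT g ->
  measurable [set w | f w < g w].
Proof.
move=> mf mg; rewrite -[X in measurable X]setTI.
exact: (measurable_fun_ltr mf mg measurableT (Y := [set true])).
Qed.

Lemma measurable_set_le d (T : measurableType d) (R : realType) (f g : T -> R) :
  measurable_fun setT f -> measurable_fun setT g ->
  measurable [set w | f w <= g w].
Proof.
move=> mf mg; rewrite -[X in measurable X]setTI.
exact: (measurable_fun_ler mf mg measurableT (Y := [set true])).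
Qed.

Lemma measurable_exists_leq d (T : measurableType d) (A : nat -> set T) n :
  (forall k, measurable (A k)) ->
  measurable [set w | exists2 k, (k <= n)%N & A k w].
Proof.
move=> mA; rewrite (_ : [set w | _] = \bigcup_(k in [set k | (k <= n)%N]) A k).
  exact: bigcup_measurable.
by apply/seteqP; split=> w /= [k kn Ak]; exists k.
Qed.

Section Fine.
Context d (T : measurableType d) (R : realType) (P : probability T R).

Lemma fine_le_prob (A B : set T) : measurable A -> measurable B -> A `<=` B ->
  fine (P A) <= fine (P B).
Proof.
move=> mA mB AB; rewrite fine_le ?fin_num_measure//.
by apply: le_measure => //; rewrite inE.
Qed.

Lemma fine_probU_le (A B : set T) : measurable A -> measurable B ->
  fine (P (A `|` B)) <= fine (P A) + fine (P B).
Proof.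
move=> mA mB; rewrite -lee_fin EFinD !fineK ?fin_num_measure//.
  exact: measureU2.
exact: measurableU.
Qed.

Lemma fine_prob_bigcup_le n (A : nat -> set T) :
  (forall i, measurable (A i)) ->
  fine (P (\bigcup_(i in [set i | (0 < i <= n)%N]) A i)) <=
  \sum_(1 <= i < n.+1) fine (P (A i)).
Proof.
move=> mA; elim: n => [|n IH].
  rewrite big_geq// (_ : [set i | _] = set0) ?bigcup_set0 ?measure0//.
  by apply/seteqP; split=> i //=; lia.
have mU : measurable (\bigcup_(i in [set i | (0 < i <= n)%N]) A i).
  exact: bigcup_measurable.
rewrite big_nat_recr//=.
have -> : [set i | (0 < i <= n.+1)%N] = [set i | (0 < i <= n)%N] `|` [set n.+1].
  apply/seteqP; split=> i /=; last by case=> [|->]; lia.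
  by have [->|] := eqVneq i n.+1; [right|left]; lia.
rewrite bigcup_setU bigcup_set1 (le_trans (fine_probU_le _ _))//.
by rewrite lerD2r.
Qed.

End Fine.

Lemma measurable_partial_sum d (T : measurableType d) (R : realType)
  (X : nat -> T -> R) n :
  (forall i, (0 < i <= n)%N -> measurable_fun setT (X i)) ->
  measurable_fun setT (partial_sum X n).
Proof.
elim: n => [|n IH] mX.
  rewrite (_ : partial_sum X 0 = cst 0)//.
  by apply/funext => w; rewrite /partial_sum big_geq.
rewrite (_ : partial_sum X n.+1 = partial_sum X n \+ X n.+1).
  apply: measurable_funD; last by apply: mX; lia.
  by apply: IH => i ?; apply: mX; lia.
by apply/funext => w; rewrite /partial_sum big_nat_recr.
Qed.

Lemma running_max_gt (T : Type) (R : realType) (X : nat -> T -> R) n x w :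
  x < running_max X n w <-> exists2 k, (k <= n)%N & x < partial_sum X k w.
Proof.
rewrite /running_max big_mkord; split.
  by case/bigmax_gtP => [h|[i _ h]]; [exists 0%N|exists i => //; rewrite -ltnS].
move=> [k kn h]; apply/bigmax_gtP; right.
by exists (Ordinal (kn : (k < n.+1)%N)).
Qed.

Lemma partial_sum_le_running_max (T : Type) (R : realType) (X : nat -> T -> R)
  n w : partial_sum X n w <= running_max X n w.
Proof.
rewrite leNgt; apply/negP => h.
suff : running_max X n w < running_max X n w by rewrite ltxx.
by apply/running_max_gt; exists n.
Qed.

Lemma measurable_running_max d (T : measurableType d) (R : realType)
  (X : nat -> T -> R) n : (forall i, (0 < i)%N -> measurable_fun setT (X i)) ->
  measurable_fun setT (running_max X n).
Proof.
move=> mX; have mS k : measurable_fun setT (partial_sum X k).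
  by apply: measurable_partial_sum => i /andP[i0 _]; exact: mX.
rewrite /running_max; elim: (index_iota 0 n.+1) => [|k s IH].
  rewrite (_ : (fun w => _) = partial_sum X 0)//.
  by apply/funext => w; rewrite big_nil.
rewrite (_ : (fun w => _) = (fun w => Num.max (partial_sum X k w)
  (\big[Num.max/partial_sum X 0 w]_(i <- s) partial_sum X i w))).
  exact: measurable_maxr.
by apply/funext => w; rewrite big_cons.
Qed.

Lemma indic_gtE (T : Type) (R : realType) (f : T -> R) m w :
  \1_[set w | m < f w] w = (m < f w)%R%:R :> R.
Proof. by rewrite indicE; congr (nat_of_bool _)%:R; apply/idP/idP; rewrite inE. Qed.

(** * Independence of a step from the past *)

Section Past.
Context d (T : measurableType d) (R : realType) (P : probability T R).
Variables (F : probability R R) (xi : nat -> {RV P >-> R}).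

(** The cylinders over the first [k] steps, numbered from 1.  They are used
    rather than the union of the preimage sigma-algebras because they are
    stable under intersection and generate the same sigma-algebra. *)
Definition past k : set (set T) :=
  [set E | exists2 B : nat -> set R, (forall i, measurable (B i)) &
     E = \bigcap_(i in [set i | (0 < i <= k)%N]) (xi i @^-1` B i)].

Lemma past_measurable k : past k `<=` measurable.
Proof.
move=> _ [B mB ->]; apply: bigcap_measurableType => i _.
by rewrite -[X in measurable X]setTI; apply: measurable_funP.
Qed.

Lemma past_setI_closed k : setI_closed (past k).
Proof.
move=> _ _ [B mB ->] [C mC ->]; exists (fun i => B i `&` C i).
  by move=> i; exact: measurableI.
by rewrite -bigcapI; apply: eq_bigcapr => i _; rewrite preimage_setI.
Qed.

Lemma pastT k : past k setT.
Proof.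
exists (fun=> setT) => //; apply/seteqP; split=> // w _ i _ //=.
Qed.

Lemma measurable_past k i : (0 < i <= k)%N ->
  @measurable_fun _ _ (g_sigma_algebraType (past k)) R setT (xi i).
Proof.
move=> ik _ B mB; rewrite setTI; apply: sub_sigma_algebra.
exists (fun j => if j == i then B else setT) => [j|].
  by case: ifP.
apply/seteqP; split=> w /=.
  by move=> wB j _ /=; case: eqP => [->|].
by move=> /(_ i ik) /=; rewrite eqxx.
Qed.

Lemma measurable_fun_past k (f : T -> R) :
  @measurable_fun _ _ (g_sigma_algebraType (past k)) R setT f ->
  measurable_fun setT f.
Proof.
move=> mf _ B mB; have := mf measurableT B mB.
apply: smallest_sub; [exact: sigma_algebra_measurable|exact: past_measurable].
Qed.

Hypothesis xi_indep : mutually_independent xi.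
Hypothesis xi_distr : forall (n : nat) (A : set R), measurable A ->
  distribution P (xi n) A = F A.

(** The product rule holds on cylinders by mutual independence.  Both sides are
    finite measures in the event of the past, so the pi-lambda theorem extends
    it to the generated sigma-algebra. *)
Lemma past_indep k (E : set T) (B : set R) : <<s past k >> E -> measurable B ->
  P (E `&` xi k.+1 @^-1` B) = (P E * F B)%E.
Proof.
move=> sE mB.
have mxB : measurable (xi k.+1 @^-1` B).
  by rewrite -[X in measurable X]setTI; apply: measurable_funP.
have r0 : 0 <= fine (F B) by rewrite fine_ge0.
pose m1 : {measure set T -> \bar R} := mrestr P mxB.
pose m2 : {measure set T -> \bar R} := mscale (NngNum r0) P.
have m1E A : m1 A = P (A `&` xi k.+1 @^-1` B) by [].
have m2E A : m2 A = (P A * F B)%E.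
  have -> : m2 A = ((fine (F B))%:E * P A)%E by [].
  by rewrite fineK ?fin_num_measure// muleC.
rewrite -m1E -m2E.
have m12 A : past k A -> m1 A = m2 A.
  move=> [C mC ->]; rewrite m1E m2E.
  (* One family of Borel sets serves for both the past and the next step. *)
  pose C' i := if (i <= k)%N then C i else B.
  pose J := [fset i in iota 1 k]%fset.
  have JE i : (i \in J) = (0 < i <= k)%N by rewrite !inE mem_iota; lia.
  have mC' i : measurable (C' i) by rewrite /C'; case: ifP.
  have JP : k.+1 \notin J by rewrite JE; lia.
  have -> : \bigcap_(i in [set i | (0 < i <= k)%N]) xi i @^-1` C i
      = \bigcap_(i in [set` J]) (xi i @^-1` C' i).
    apply: eq_bigcap => [|i].
      by split=> i /=; rewrite JE.
    by rewrite /= => /andP[_ ik]; rewrite /C' ik.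
  rewrite (xi_indep J mC').
  have -> : \bigcap_(i in [set` J]) (xi i @^-1` C' i) `&` xi k.+1 @^-1` B
     = \bigcap_(i in [set` (k.+1 |` J)%fset]) (xi i @^-1` C' i).
    rewrite set_fsetU set_fset1 bigcap_setU bigcap_set1 setIC.
    by congr (xi _ @^-1` _ `&` _); rewrite /C' ltnn.
  rewrite (xi_indep (k.+1 |` J)%fset mC') big_fsetU1//=.
  rewrite muleC; congr (_ * _)%E; rewrite /C' ltnn; exact: xi_distr.
have m1oo : forall _ : nat, (m1 setT < +oo)%E.
  move=> _; rewrite m1E setTI.
  by rewrite (le_lt_trans (probability_le1 _ _))// ltry.
apply: (@g_sigma_algebra_measure_unique _ R T (past k) (@past_measurable k)
  (fun=> setT) (fun=> pastT k) _ m1 m2 (@past_setI_closed k) m12 m1oo E sE).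
by rewrite bigcup_const//; exists 0%N.
Qed.

(** By [past_indep] the joint law of [Z] and the next step is the product of
    their laws, and the identity is Tonelli's theorem for that product. *)
Lemma integral_past_indep k (Z : T -> R) (f : R -> R) :
  @measurable_fun _ _ (g_sigma_algebraType (past k)) R setT Z ->
  measurable_fun setT f -> (forall w, 0 <= Z w) -> (forall z, 0 <= f z) ->
  (\int[P]_w (Z w * f (xi k.+1 w))%:E =
   (\int[P]_w (Z w)%:E) * \int[F]_z (f z)%:E)%E.
Proof.
move=> mZ mf Z0 f0.
have mZT := measurable_fun_past mZ.
have mX : measurable_fun setT (xi k.+1) by [].
pose ZX w := (Z w, xi k.+1 w).
have mZX : measurable_fun setT ZX by exact: measurable_fun_pair.
pose PZ := distribution P (mfun_Sub (mem_set mZT : Z \in mfun)).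
pose m' := pushforward P ZX.
(* The absolute value, harmless on the values of Z, makes h nonnegative on the
   whole plane. *)
pose h (z : R * R) : R := `|z.1| * f z.2.
have mh : measurable_fun setT h.
  apply: measurable_funM.
    by apply: measurableT_comp => //; exact: measurable_fst.
  by apply: measurableT_comp => //; exact: measurable_snd.
have h0 z : (0 <= (h z)%:E)%E by rewrite lee_fin mulr_ge0.
have mhE : measurable_fun setT (EFin \o h) by exact/measurable_EFinP.
transitivity (\int[m']_z (EFin \o h) z)%E.
  rewrite ge0_integral_pushforward//=.
  by apply: eq_integral => w _ /=; rewrite /h /= ger0_norm.
transitivity (\int[PZ \x F]_z (EFin \o h) z)%E.
  apply: eq_measure_integral => C mC _; symmetry.
  apply: (@product_measure_unique _ _ _ _ _ PZ F m') => // A B mA mB.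
  transitivity (P ((Z @^-1` A) `&` (xi k.+1 @^-1` B))); first by [].
  rewrite past_indep//.
  by have := mZ measurableT A mA; rewrite setTI.
rewrite fubini_tonelli1// /fubini_F /=.
have -> : (\int[F]_z (f z)%:E)%E = (\int[F]_z (EFin \o f) z)%E by [].
have mfE : measurable_fun setT (EFin \o f) by exact/measurable_EFinP.
have mn : measurable_fun setT (fun u : R => `|u|%:E).
  by apply/measurable_EFinP; exact: normr_measurable.
transitivity (\int[PZ]_x (`|x|%:E * \int[F]_z (EFin \o f) z))%E.
  apply: eq_integral => u _; rewrite -ge0_integralZl//.
  - by move=> z _ /=; rewrite lee_fin.
rewrite ge0_integralZr//; last first.
  by apply: integral_ge0 => z _ /=; rewrite lee_fin.
congr (_ * _)%E.
rewrite ge0_integral_distribution//=.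
by apply: eq_integral => w _ /=; rewrite ger0_norm.
Qed.

End Past.

(** * An exponential maximal inequality *)

Section Maximal.
Context d (T : measurableType d) (R : realType) (P : probability T R).
Variables (F : probability R R) (xi : nat -> {RV P >-> R}).
Hypothesis xi_indep : mutually_independent xi.
Hypothesis xi_distr : forall (n : nat) (A : set R), measurable A ->
  distribution P (xi n) A = F A.

(** The product of the factors [Y (xi i)], frozen as soon as it reaches the
    level [t].  With [Y] a truncated exponential it is the exponential of the
    walk stopped at a first passage time; its mean grows by a factor of at
    most [phi] per step when [1 <= phi] bounds the mean of [Y]. *)
Fixpoint stopped_prod (Y : R -> R) (t : R) k (w : T) : R :=
  if k is k'.+1 then
    stopped_prod Y t k' w *
      (if t <= stopped_prod Y t k' w then 1 else Y (xi k w))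
  else 1.

Lemma stopped_prod_ge0 (Y : R -> R) (t : R) k w : (forall z, 0 <= Y z) ->
  0 <= stopped_prod Y t k w.
Proof. by move=> Y0; elim: k => //= k IH; rewrite mulr_ge0//; case: ifP. Qed.

(** The map [f] allows the domain to carry another sigma-algebra, such as that
    of the past. *)
Lemma measurable_stopped_prod (Y : R -> R) (t : R) k (d' : measure_display)
    (T' : measurableType d') (f : T' -> T) :
  measurable_fun setT Y ->
  (forall i, (0 < i <= k)%N -> measurable_fun setT (xi i \o f)) ->
  measurable_fun setT (stopped_prod Y t k \o f).
Proof.
move=> mY; elim: k => [|k IH] mX /=.
  exact: measurable_cst.
have mk : measurable_fun setT (stopped_prod Y t k \o f).
  by apply: IH => i ik; apply: mX; lia.
apply: measurable_funM => //.
apply: measurable_fun_ifT => //.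
- exact: measurable_fun_ler.
- apply: (measurableT_comp mY); apply: (mX k.+1); lia.
Qed.

(** Each new factor is 1 or is independent of the current product, so it
    multiplies the mean by at most [phi]; [1 <= phi] covers the frozen part. *)
Lemma integral_stopped_prod_le (Y : R -> R) (t phi : R) k :
  measurable_fun setT Y -> (forall z, 0 <= Y z) -> 1 <= phi ->
  (\int[F]_z (Y z)%:E <= phi%:E)%E ->
  (\int[P]_w (stopped_prod Y t k w)%:E <= (phi ^+ k)%:E)%E.
Proof.
move=> mY Y0 phi1 Yphi; elim: k => [|k IH].
  by rewrite /= integral_cst// mul1e probability_le1.
pose Z := stopped_prod Y t k.
have Z0 w : 0 <= Z w by exact: stopped_prod_ge0.
have mZp : @measurable_fun _ _ (g_sigma_algebraType (past xi k)) R setT Z.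
  apply: (@measurable_stopped_prod Y t k _
    (g_sigma_algebraType (past xi k)) id mY) => i ik.
  exact: measurable_past.
have mZ := measurable_fun_past mZp.
(* Z1 is the frozen part, Z2 the part that is still moving. *)
pose Z1 w := if t <= Z w then Z w else 0.
pose Z2 w := if t <= Z w then 0 else Z w.
have Z10 w : 0 <= Z1 w by rewrite /Z1; case: ifP.
have Z20 w : 0 <= Z2 w by rewrite /Z2; case: ifP.
have mZ2p : @measurable_fun _ _ (g_sigma_algebraType (past xi k)) R setT Z2.
  by apply: measurable_fun_ifT => //; exact: measurable_fun_ler.
have mZ2 := measurable_fun_past mZ2p.
have mZ1 : measurable_fun setT Z1.
  by apply: measurable_fun_ifT => //; exact: measurable_fun_ler.
have mYx : measurable_fun setT (fun w => Y (xi k.+1 w)).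
  exact: measurableT_comp.
have -> : (\int[P]_w (stopped_prod Y t k.+1 w)%:E =
  \int[P]_w ((Z1 w)%:E + (Z2 w * Y (xi k.+1 w))%:E))%E.
  apply: eq_integral => w _; rewrite -EFinD /= -/(Z w) /Z1 /Z2.
  by case: ifP => _; rewrite ?mulr1 ?mul0r ?addr0 ?add0r.
rewrite ge0_integralD//; last 4 first.
- by move=> w _; rewrite lee_fin.
- exact/measurable_EFinP.
- by move=> w _; rewrite lee_fin mulr_ge0.
- by apply/measurable_EFinP; exact: measurable_funM.
rewrite (integral_past_indep xi_indep xi_distr)//.
have I10 : (0 <= \int[P]_w (Z1 w)%:E)%E.
  by apply: integral_ge0 => w _; rewrite lee_fin.
have I20 : (0 <= \int[P]_w (Z2 w)%:E)%E.
  by apply: integral_ge0 => w _; rewrite lee_fin.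
have -> : (phi ^+ k.+1)%:E = ((phi ^+ k)%:E * phi%:E)%E.
  by rewrite exprSr EFinM.
apply: (@le_trans _ _ ((\int[P]_w (Z1 w)%:E + \int[P]_w (Z2 w)%:E) * phi%:E)%E).
  have aux (a b c : \bar R) : (0 <= a -> 0 <= b -> c <= phi%:E ->
      a + b * c <= (a + b) * phi%:E)%E.
    move=> a0 b0 cphi; rewrite ge0_muleDl//; apply: leeD.
      by rewrite lee_pemulr// lee_fin.
    exact: lee_wpmul2l.
  exact: aux.
apply: lee_wpmul2r; first by rewrite lee_fin (le_trans _ phi1).
apply: le_trans IH; rewrite -ge0_integralD//; last 4 first.
- by move=> w _; rewrite lee_fin.
- exact/measurable_EFinP.
- by move=> w _; rewrite lee_fin.
- exact/measurable_EFinP.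
apply: ge0_le_integral => //.
- by move=> w _; rewrite -EFinD lee_fin addr_ge0.
- under eq_fun do rewrite -EFinD.
  by apply/measurable_EFinP; exact: measurable_funD.
- exact/measurable_EFinP.
- move=> w _; rewrite -EFinD lee_fin /Z1 /Z2.
  by case: ifP; rewrite ?addr0 ?add0r.
Qed.

(** If no increment exceeds [v], the truncated exponentials are genuine ones
    and the product reaches [expR (lam * y)] as soon as the walk reaches [y].
    Markov's inequality for [stopped_prod] bounds that event, and a union bound
    the event of an increment above [v]. *)
Lemma exponential_maximal_bound (g : R -> R) (lam v y phi : R) n :
  measurable_fun setT g -> 0 < lam -> 0 < y -> 1 <= phi ->
  (\int[F]_z (if g z <= v then expR (lam * g z) else 0)%:E <= phi%:E)%E ->
  fine (P [set w | exists2 k, (k <= n)%N &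
                     y <= partial_sum (fun i => g \o xi i) k w]) <=
  n%:R * fine (F [set z | v < g z]) + phi ^+ n * expR (- (lam * y)).
Proof.
move=> mg lam0 y0 phi1 Yphi.
pose Y z := if g z <= v then expR (lam * g z) else 0.
pose t := expR (lam * y).
pose W := partial_sum (fun i => g \o xi i).
pose Z := stopped_prod Y t.
have Y0 z : 0 <= Y z by rewrite /Y; case: ifP => _ //; exact: expR_ge0.
have mY : measurable_fun setT Y.
  apply: measurable_fun_ifT => //; first exact: measurable_fun_ler.
  by apply: measurableT_comp => //; exact: measurable_funM.
have mW k : measurable_fun setT (W k).
  by apply: measurable_partial_sum => i _; exact: measurableT_comp.
have mZ k : measurable_fun setT (Z k).
  exact: (@measurable_stopped_prod Y t k _ T id).
have mA : measurable [set w | exists2 k, (k <= n)%N & y <= W k w].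
  apply: (measurable_exists_leq (A := fun k => [set w | y <= W k w])) => k.
  exact: measurable_set_le.
have mB i : measurable [set w | v < g (xi i w)].
  apply: measurable_set_lt => //.
  exact: measurableT_comp.
have mC : measurable [set w | t <= Z n w].
  exact: measurable_set_le.
have sub : [set w | exists2 k, (k <= n)%N & y <= W k w] `<=`
  (\bigcup_(i in [set i | (0 < i <= n)%N]) [set w | v < g (xi i w)])
  `|` [set w | t <= Z n w].
  move=> w /= [k0 k0n yk0].
  have [|nv] := pselect ((\bigcup_(i in [set i | (0 < i <= n)%N])
    [set w | v < g (xi i w)]) w); [by left|right].
  have gv i : (0 < i <= n)%N -> g (xi i w) <= v.
    by move=> i0n; rewrite leNgt; apply/negP => vi; apply: nv; exists i.
  have H k : (k <= n)%N -> t <= Z k w \/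
    (Z k w = expR (lam * W k w) /\ forall j, (j <= k)%N -> W j w < y).
    elim: k => [_|k IH kn].
      right; rewrite /W /partial_sum big_geq//; split.
        by rewrite mulr0 expR0.
      by move=> [|//] _; rewrite big_geq.
    have [tZ|[ZE Wy]] := IH (ltnW kn).
      by left; rewrite /Z /= -/(Z k w) tZ mulr1.
    have tZF : (t <= Z k w) = false.
      apply/negbTE; rewrite -ltNge ZE ltr_expR ltr_pM2l//; exact: Wy.
    have ZE' : Z k.+1 w = expR (lam * W k.+1 w).
      rewrite /Z /= -/(Z k w) tZF ZE /Y gv//.
      by rewrite -expRD -mulrDr /W /partial_sum [in RHS]big_nat_recr.
    have [yW|Wy'] := leP y (W k.+1 w).
      by left; rewrite ZE' ler_expR ler_pM2l.
    right; split=> // j; rewrite leq_eqVlt => /orP[/eqP->//|jk].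
    exact: Wy.
  have [//|[_ /(_ k0 k0n)]] := H n (leqnn n).
  by rewrite ltNge yk0.
have mU : measurable (\bigcup_(i in [set i | (0 < i <= n)%N])
    [set w | v < g (xi i w)]).
  exact: bigcup_measurable.
apply: (le_trans (fine_le_prob P mA _ sub)); first exact: measurableU.
apply: (le_trans (fine_probU_le _ _ _)) => //; apply: lerD.
  apply: (le_trans (fine_prob_bigcup_le P n mB)).
  rewrite (eq_bigr (fun=> fine (F [set z | v < g z]))).
    by rewrite sumr_const_nat subSS subn0 mulr_natl.
  move=> i _; congr fine; rewrite -(xi_distr i)//.
  exact: measurable_set_lt.
have t0 : 0 < t by exact: expR_gt0.
rewrite expRN -/t ler_pdivlMr// -lee_fin EFinM fineK ?fin_num_measure//.
apply: le_trans (integral_stopped_prod_le t n mY Y0 phi1 Yphi).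
rewrite muleC -[X in P X]setIT -integral_indic//.
rewrite -ge0_integralZl//; last 2 first.
- by apply/measurable_EFinP; exact: measurable_indic.
- by rewrite lee_fin ltW.
have Z0 w : 0 <= Z n w by exact: stopped_prod_ge0.
apply: ge0_le_integral => //.
- by move=> w _; rewrite -EFinM lee_fin mulr_ge0// ltW.
- under eq_fun do rewrite -EFinM.
  apply/measurable_EFinP; apply: measurable_funM => //.
- exact/measurable_EFinP.
- move=> w _; rewrite -EFinM lee_fin indicE; case: (boolP (_ \in _)) => wZ /=.
    by rewrite mulr1; rewrite inE in wZ.
  by rewrite mulr0; exact: Z0.
Qed.

End Maximal.

(** * Integrable variables *)

Section Integrable.
Context d (T : measurableType d) (R : realType) (mu : probability T R).
Variable f : T -> R.
Hypothesis intf : mu.-integrable setT (EFin \o f).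

Let mf : measurable_fun setT f.
Proof. by apply/measurable_EFinP; case/integrableP: intf. Qed.

Definition large_part (L : R) (w : T) : R := if L < `|f w| then `|f w| else 0.

Lemma large_part_ge0 L w : 0 <= large_part L w.
Proof. by rewrite /large_part; case: ifP. Qed.

Lemma measurable_large_part L : measurable_fun setT (large_part L).
Proof.
have mn : measurable_fun setT (fun w => `|f w|) by exact: measurableT_comp.
by apply: measurable_fun_ifT => //; exact: measurable_fun_ltr.
Qed.

Lemma integrable_large_part L : mu.-integrable setT (EFin \o large_part L).
Proof.
apply: le_integrable intf => //.
  by apply/measurable_EFinP; exact: measurable_large_part.
move=> w _; rewrite /= lee_fin /large_part.
by case: ifP; rewrite ?normr_id// normr0.
Qed.

(** Dominated convergence: the large parts at integer levels decrease to 0. *)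
Lemma integral_large_part_small (e : R) : 0 < e ->
  exists L, 0 < L /\ \int[mu]_w large_part L w <= e.
Proof.
move=> e0.
have [|||||_ _ +] := @dominated_convergence _ _ _ mu setT measurableT
  (fun n => EFin \o large_part n.+1%:R) (cst 0)%E (abse \o (EFin \o f)).
- by move=> n; apply/measurable_EFinP; exact: measurable_large_part.
- exact: measurable_cst.
- apply: aeW => w _; apply: cvg_near_cst.
  near=> n; rewrite /= /large_part ifF//; apply/negbTE; rewrite -leNgt.
  near: n; exists (Num.truncn `|f w|) => // n /= fn.
  apply: ltW; apply: lt_le_trans (truncnS_gt _) _.
  by rewrite ler_nat.
- exact: integrable_abse.
- apply: aeW => w n _ /=; rewrite lee_fin /large_part.
  by case: ifP; rewrite ?normr_id// normr0.
rewrite integral0 => /fine_cvgP[_ /cvgr_lt /= /(_ e e0) [n _ /(_ n (leqnn n))]].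
by move=> /= h; exists n.+1%:R; split=> //; exact: ltW.
Unshelve. all: by end_near. Qed.

(** Markov's inequality on the large part, which improves [O(1 / t)] to
    [o(1 / t)]. *)
Lemma mul_tail_small (e : R) : 0 < e ->
  exists L, forall t, L <= t -> t * fine (mu [set w | t < `|f w|]) <= e.
Proof.
move=> /integral_large_part_small[L [L0 Le]]; exists L => t Lt.
have mn : measurable_fun setT (fun w => `|f w|) by exact: measurableT_comp.
have mA : measurable [set w | t < `|f w|].
  exact: (measurable_set_lt (measurable_cst t) mn).
apply: le_trans Le.
have -> : t * fine (mu [set w | t < `|f w|]) =
    \int[mu]_w (t * \1_[set w | t < `|f w|] w).
  rewrite RintegralZl//; last exact: integrable_indic.
  by rewrite /Rintegral integral_indic// setIT.
apply: le_Rintegral => //.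
- have := integrableZl measurableT t (integrable_indic mu mA).
  by apply: eq_integrable => // w _ /=.
- exact: integrable_large_part.
move=> w _; rewrite indicE /large_part; case: (boolP (_ \in _)) => /=.
  rewrite inE /= => tf; rewrite mulr1 (le_lt_trans Lt tf); exact: ltW.
by rewrite mulr0 => _; case: ifP.
Qed.

(** Truncation at [lam * f <= 1] makes a first moment sufficient: values of
    [f] below [L] give a quadratic error [lam ^ 2 * L ^ 2], negligible
    against the drift [lam * eta], while the square of a value above [L] is
    dominated by its first power, whose mean on that range is small by
    [integral_large_part_small].  Very negative values only help. *)
Lemma exp_moment_le1 : \int[mu]_w f w < 0 ->
  exists lam0, 0 < lam0 /\ forall lam, 0 < lam <= lam0 ->
    (\int[mu]_w (if lam * f w <= 1 then expR (lam * f w) else 0)%:E <= 1)%E.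
Proof.
move=> Ef; set eta := - \int[mu]_w f w.
have eta0 : 0 < eta by rewrite oppr_gt0.
have [L [L0 hL]] := @integral_large_part_small (eta / 6) ltac:(lra).
exists (eta / (4 * L ^+ 2)); split=> [|lam /andP[lam0 lamle]].
  by rewrite divr_gt0// mulr_gt0// exprn_gt0.
have lamL : 2 * lam ^+ 2 * L ^+ 2 <= lam * (eta / 2).
  move: lamle; rewrite ler_pdivlMr; last by rewrite mulr_gt0// exprn_gt0.
  by move=> h; nra.
pose c := 1 + 2 * lam ^+ 2 * L ^+ 2.
(* h dominates the truncated exponential.  The factor 3 on the large part
   covers the quadratic term, with coefficient 2, of a value above L, and the
   linear term of a value below -L. *)
pose h w := c + (lam * f w + 3 * lam * large_part L w).
have intlp := integrable_large_part L.
have i1 : mu.-integrable setT (EFin \o (fun w => lam * f w)).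
  have := integrableZl measurableT lam intf.
  by apply: eq_integrable => // w _ /=.
have i2 : mu.-integrable setT (EFin \o (fun w => 3 * lam * large_part L w)).
  have := integrableZl measurableT (3 * lam) intlp.
  by apply: eq_integrable => // w _ /=.
have i12 : mu.-integrable setT
    (EFin \o (fun w => lam * f w + 3 * lam * large_part L w)).
  have := integrableD measurableT i1 i2.
  by apply: eq_integrable => // w _ /=.
have ic : mu.-integrable setT (EFin \o (fun=> c)).
  exact: finite_measure_integrable_cst.
have ih : mu.-integrable setT (EFin \o h).
  have := integrableD measurableT ic i12.
  by apply: eq_integrable => // w _ /=.
have Eh : \int[mu]_w h w <= 1.
  rewrite (RintegralD measurableT ic i12) (RintegralD measurableT i1 i2).
  rewrite (RintegralZl _ measurableT intf) (RintegralZl _ measurableT intlp).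
  rewrite Rintegral_cst// [fine _](_ : _ = 1) ?mulr1 /c; last first.
    by rewrite -[RHS]/(fine 1%E); congr fine; exact: probability_setT.
  have -> : \int[mu]_w f w = - eta by rewrite opprK.
  by move: hL; set I := \int[mu]_w _ => hL; nra.
have le_h w : (if lam * f w <= 1 then expR (lam * f w) else 0) <= h w.
  have l0 := large_part_ge0 L w.
  rewrite /h /c; case: ifP => [fw1|/negbT]; last first.
    rewrite -ltNge => fw1; have q0 : 0 <= lam ^+ 2 * L ^+ 2.
      by rewrite mulr_ge0// sqr_ge0.
    nra.
  have [fL|fL] := leP (`|f w|) L.
    have e := expR_le_quadratic fw1.
    have : (f w) ^+ 2 <= L ^+ 2.
      by rewrite -[(f w) ^+ 2]real_normK ?num_real// lerXn2r ?nnegrE// ltW.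
    rewrite exprMn in e => fl2.
    have q : lam ^+ 2 * f w ^+ 2 <= lam ^+ 2 * L ^+ 2.
      by rewrite ler_wpM2l ?sqr_ge0.
    by have := mulr_ge0 (ltW lam0) l0; lra.
  have lpE : large_part L w = `|f w| by rewrite /large_part fL.
  have q0 : 0 <= lam ^+ 2 * L ^+ 2 by rewrite mulr_ge0// sqr_ge0.
  rewrite lpE; have [f0|f0] := leP 0 (f w).
    have e := expR_le_quadratic fw1.
    rewrite ger0_norm// in fL *.
    have : (lam * f w) ^+ 2 <= lam * f w.
      by rewrite expr2 ler_piMl// mulr_ge0// ltW.
    by have := mulr_ge0 (ltW lam0) f0; lra.
  rewrite ltr0_norm//.
  have : expR (lam * f w) <= 1.
    by rewrite expR_le1 mulr_ge0_le0// ltW.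
  by nra.
apply: (@le_trans _ _ (\int[mu]_w (h w)%:E)%E).
  apply: ge0_le_integral => //.
  - by move=> w _; rewrite lee_fin; case: ifP => // _; exact: expR_ge0.
  - apply/measurable_EFinP; apply: measurable_fun_ifT => //.
      by apply: measurable_fun_ler => //; exact: measurable_funM.
    by apply: measurableT_comp => //; exact: measurable_funM.
  - by case/integrableP: ih.
  - by move=> w _; rewrite lee_fin; exact: le_h.
have Ifin := integrable_fin_num measurableT ih.
by move: Eh; rewrite -lee_fin /Rintegral fineK.
Qed.

End Integrable.

Section Transfer.
Context d (T : measurableType d) (R : realType) (P : probability T R).
Variables (F : probability R R) (X : {RV P >-> R}).
Hypothesis X_distr : forall A : set R, measurable A -> distribution P X A = F A.
Hypothesis intX : P.-integrable setT (EFin \o X).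

Lemma law_integrable : F.-integrable setT (EFin \o id).
Proof.
apply/integrableP; split; first by apply/measurable_EFinP; exact: measurable_id.
have mn : measurable_fun setT (fun z : R => (`|z|)%:E).
  by apply/measurable_EFinP; exact: normr_measurable.
have -> : (\int[F]_z `|(EFin \o id) z| = \int[distribution P X]_z (`|z|)%:E)%E.
  by symmetry; apply: eq_measure_integral => A mA _; exact: X_distr.
rewrite ge0_integral_distribution//.
by case/integrableP: intX.
Qed.

Lemma law_mean : \int[F]_z z = \int[P]_w X w.
Proof.
congr fine.
transitivity (\int[distribution P X]_z z%:E)%E.
  by symmetry; apply: eq_measure_integral => A mA _; exact: X_distr.
by rewrite integral_distribution.
Qed.

End Transfer.

(** * Dominated variation *)

Section Tail.
Context (R : realType).
Implicit Types (G : probability R R) (x y u : R).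

Lemma tailE G x : tail G x = fine (G [set z | x < z]).
Proof.
by rewrite /tail; congr (fine (G _)); apply/seteqP; split=> z /=;
  rewrite in_itv /= andbT.
Qed.

Lemma measurable_gt x : measurable [set z : R | x < z].
Proof. by apply: measurable_set_lt => //; exact: measurable_id. Qed.

Lemma tail_ge0 G x : 0 <= tail G x.
Proof. by rewrite fine_ge0. Qed.

Lemma tail_le G x y : x <= y -> tail G y <= tail G x.
Proof.
move=> xy; rewrite !tailE; apply: fine_le_prob; try exact: measurable_gt.
by move=> z /=; exact: le_lt_trans.
Qed.

(** Iterating [tail G x <= c * tail G (2 * x)] about [log u] times gives a
    power of [u], its degree being the integer [p] with [c <= 2 ^ p]. *)
Lemma tail_polynomial G : dominated_varying G ->
  exists p : nat, exists C : R, 0 < C /\ forall y u, 0 < y -> 1 <= u ->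
    tail G (y / u) <= C * u ^+ p * tail G y.
Proof.
move=> [G0 [c Gc]].
have c1 : 1 <= c.
  have := Gc 0; rewrite mulr0 => h.
  by rewrite -(ler_pM2r (G0 0)) mul1r.
have c0 : 0 <= c by lra.
have Gj y j : tail G (y / 2 ^+ j) <= c ^+ j * tail G y.
  elim: j => [|j IH]; first by rewrite !expr0 divr1 mul1r.
  apply: (le_trans (Gc _)); rewrite exprS.
  have -> : 2 * (y / (2 * 2 ^+ j)) = y / 2 ^+ j :> R.
    by field; rewrite expf_neq0// pnatr_eq0.
  by rewrite exprS -mulrA ler_wpM2l.
pose p := Num.truncn c.
have cp : c <= 2 ^+ p.
  apply: ltW; apply: lt_le_trans (truncnS_gt c) _.
  by rewrite -natrX ler_nat ltn_expl.
exists p, (2 ^+ p); split=> [|y u y0 u1]; first by rewrite exprn_gt0.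
have u0 : 0 < u by lra.
have [j ju jmin] : exists2 j, u <= 2 ^+ j & 2 ^+ j <= 2 * u.
  have ex : exists j, u <= 2 ^+ j.
    exists (Num.truncn u).+1; apply: ltW; apply: lt_le_trans (truncnS_gt u) _.
    by rewrite -natrX ler_nat ltnW// ltn_expl.
  case: (ex_minnP ex) => -[|j] uj jmin.
    by exists 0%N => //; rewrite expr0; lra.
  exists j.+1 => //; rewrite exprS ler_pM2l//.
  by rewrite leNgt; apply/negP => /ltW/jmin; rewrite ltnn.
have e2 : 0 < 2 ^+ j :> R by rewrite exprn_gt0.
apply: (@le_trans _ _ (tail G (y / 2 ^+ j))).
  by apply: tail_le; rewrite ler_pM2l// lef_pV2.
apply: (le_trans (Gj y j)); apply: ler_wpM2r; first exact: tail_ge0.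
apply: (@le_trans _ _ ((2 ^+ p) ^+ j)).
  by rewrite lerXn2r// nnegrE// exprn_ge0.
by rewrite exprAC -exprMn lerXn2r// nnegrE ?exprn_ge0//; lra.
Qed.

(** A dominated varying tail decays at most polynomially, by [tail_polynomial]
    with [u = y]. *)
Lemma tail_inv_le_expR G (lam : R) : dominated_varying G -> 0 < lam ->
  exists Y, forall y, Y <= y -> (tail G y)^-1 <= expR (lam * y).
Proof.
move=> Gdom lam0; have [G0 _] := Gdom.
have [p [C [C0 HC]]] := tail_polynomial Gdom.
pose A := C * p.+1`!%:R / (tail G 1 * lam ^+ p.+1).
exists (1 + `|A|) => y Yy.
have [y1 yA] : 1 <= y /\ A <= y.
  by have := ler_norm A; have := normr_ge0 A; split; lra.
have y0 : 0 < y by lra.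
have ty0 := G0 y; set ty := tail G y in ty0 *.
have e1 := @exprn_le_expR R (lam * y) p.+1 (mulr_ge0 (ltW lam0) (ltW y0)).
have t1 : tail G 1 <= C * y ^+ p * ty.
  by have := HC y y y0 y1; rewrite divff// gt_eqF.
have l0 : 0 < lam ^+ p.+1 by rewrite exprn_gt0.
have A1 : C * p.+1`!%:R <= y * (tail G 1 * lam ^+ p.+1).
  by move: yA; rewrite ler_pdivrMr// mulr_gt0.
have f0 : 0 < p.+1`!%:R :> R by rewrite ltr0n fact_gt0.
rewrite exprMn in e1.
rewrite -[leLHS]mul1r ler_pdivrMr//.
rewrite -(ler_pM2l f0) mulr1 -(ler_pM2l C0); apply: (le_trans A1).
apply: (@le_trans _ _ (y * (C * y ^+ p * ty * lam ^+ p.+1))).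
  by rewrite ler_wpM2l ?(ltW y0)// ler_wpM2r// ltW.
rewrite [leLHS](_ : _ = C * ty * (lam ^+ p.+1 * y ^+ p.+1)); last first.
  by rewrite [y ^+ p.+1]exprS; ring.
rewrite [leRHS](_ : _ = C * ty * (p.+1`!%:R * expR (lam * y))); last by ring.
by rewrite ler_wpM2l// mulr_ge0// ltW.
Qed.

End Tail.

(** * Bounds for walks with drift *)

Section Walk.
Context d (T : measurableType d) (R : realType) (P : probability T R).
Variables (F : probability R R) (xi : nat -> {RV P >-> R}).
Hypothesis xi_indep : mutually_independent xi.
Hypothesis xi_distr : forall (n : nat) (A : set R), measurable A ->
  distribution P (xi n) A = F A.
Hypothesis intF : F.-integrable setT (EFin \o id).

Let a := \int[F]_z z.

Lemma measurable_walk n : measurable_fun setT (partial_sum xi n).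
Proof. by apply: measurable_partial_sum => i _. Qed.

Lemma integrable_affine (s b : R) :
  F.-integrable setT (EFin \o (fun z => s * z + b)) /\
  \int[F]_z (s * z + b) = s * a + b.
Proof.
have ib : F.-integrable setT (EFin \o (fun=> b)).
  exact: finite_measure_integrable_cst.
have iz : F.-integrable setT (EFin \o (fun z => s * z)).
  by have := integrableZl measurableT s intF; apply: eq_integrable.
split; first by have := integrableD measurableT iz ib; apply: eq_integrable.
rewrite (RintegralD measurableT iz ib) (RintegralZl _ measurableT intF).
rewrite Rintegral_cst// [fine _](_ : _ = 1) ?mulr1//.
by rewrite -[RHS]/(fine 1%E); congr fine; exact: probability_setT.
Qed.

(** One half of the weak law of large numbers under a first moment.  Shift the
    steps by [b'] halfway between [b] and [a] and change sign: the drift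
    becomes negative, and [partial_sum xi n w <= b * n%:R] makes the new walk
    exceed [h * n].  With [lam = B / n] and truncation at [1 / lam],
    [exponential_maximal_bound] leaves [expR (- B * h)] and
    [n * P (step > n / B)], the latter tending to 0 by [mul_tail_small]. *)
Lemma walk_lower_lln (b e : R) : b < a -> 0 < e -> exists n0 : nat,
  forall n, (n0 <= n)%N ->
    fine (P [set w | partial_sum xi n w <= b * n%:R]) <= e.
Proof.
move=> ba e0; pose b' := (a + b) / 2; pose h := b' - b.
have h0 : 0 < h by rewrite /h /b'; lra.
pose g z := - 1 * z + b'.
have [intg Eg] := integrable_affine (- 1) b'.
have Eg0 : \int[F]_z g z < 0 by rewrite Eg /b'; lra.
have mg : measurable_fun setT g.
  by apply/measurable_EFinP; case/integrableP: intg.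
have [lam0 [lam00 Hlam]] := exp_moment_le1 intg Eg0.
(* This makes expR (- B * h) = expR (- 2 / e), which is at most e / 2. *)
pose B := 2 / (e * h).
have B0 : 0 < B by rewrite divr_gt0// mulr_gt0.
have [|L HL] := mul_tail_small intg (e := e / (2 * B)).
  by rewrite divr_gt0// mulr_gt0.
exists (Num.truncn (`|B / lam0| + `|B * L|)).+1 => n n0n.
have nBL : `|B / lam0| + `|B * L| <= n%:R.
  by apply: ltW; apply: lt_le_trans (truncnS_gt _) _; rewrite ler_nat.
have nlam : B / lam0 <= n%:R.
  by apply: le_trans nBL; apply: (le_trans (ler_norm _)); rewrite lerDl.
have nL : B * L <= n%:R.
  by apply: le_trans nBL; apply: (le_trans (ler_norm _)); rewrite lerDr.
have n0 : 0 < n%:R :> R by rewrite ltr0n; exact: leq_trans n0n.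
pose lam := B / n%:R.
have lam_gt0 : 0 < lam by rewrite divr_gt0.
have y0 : 0 < h * n%:R by rewrite mulr_gt0.
have v0 : 0 < n%:R / B by rewrite divr_gt0.
have max := exponential_maximal_bound xi_indep xi_distr (v := n%:R / B) n mg
  lam_gt0 y0 (lexx 1).
have sub : [set w | partial_sum xi n w <= b * n%:R] `<=`
  [set w | exists2 k, (k <= n)%N &
    h * n%:R <= partial_sum (fun i => g \o xi i) k w].
  move=> w /= Sw; exists n => //.
  rewrite /partial_sum (eq_bigr (fun i => b' - xi i w)); last first.
    by move=> i _; rewrite /= /g mulN1r addrC.
  by rewrite sumrB sumr_const_nat subSS subn0 -[b' *+ n]mulr_natr /h mulrBl lerB.
have mA : measurable [set w | partial_sum xi n w <= b * n%:R].
  by apply: measurable_set_le => //; exact: measurable_walk.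
have mB : measurable [set w | exists2 k, (k <= n)%N &
    h * n%:R <= partial_sum (fun i => g \o xi i) k w].
  apply: (measurable_exists_leq (A := fun k =>
    [set w | h * n%:R <= partial_sum (fun i => g \o xi i) k w])) => k.
  apply: measurable_set_le => //.
  by apply: measurable_partial_sum => i _; exact: measurableT_comp.
have step := fine_le_prob P mA mB sub.
apply: (le_trans step) => {step}.
apply: (le_trans (max _)).
  apply: le_trans (Hlam lam _).
    rewrite le_eqVlt; apply/orP; left; apply/eqP; apply: eq_integral => z _.
    by rewrite /lam mulrAC ler_pdivrMr// mul1r ler_pdivlMr// mulrC.
  by rewrite lam_gt0 /lam ler_pdivrMr// -ler_pdivrMl// mulrC.
rewrite expr1n mul1r (_ : e = e / 2 + e / 2); last by lra.
apply: lerD.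
  have := HL (n%:R / B); rewrite ler_pdivlMr// mulrC => /(_ nL) HL1.
  have le1 : fine (F [set z | n%:R / B < g z]) <=
      fine (F [set z | n%:R / B < `|g z|]).
    apply: fine_le_prob.
    - exact: measurable_set_lt.
    - by apply: measurable_set_lt => //; exact: measurableT_comp.
    - by move=> z /= /lt_le_trans; apply; exact: ler_norm.
  have := ler_wpM2l (ltW v0) le1 => /le_trans/(_ HL1).
  rewrite -[_ / B * _](mulrAC _ _ (B^-1)) ler_pdivrMr// => /le_trans; apply.
  by rewrite (_ : e / (2 * B) * B = e / 2)//; field; rewrite gt_eqF.
have -> : lam * (h * n%:R) = 2 / e.
  by rewrite /lam /B; field; rewrite !gt_eqF.
rewrite expRN -[leRHS]invrK lef_pV2 ?posrE ?expR_gt0//; last first.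
  by rewrite invr_gt0 divr_gt0.
rewrite invfM invrK mulrC; apply: le_trans (expR_ge1Dx _); lra.
Qed.

(** Values of the shifted step up to [1 / lam] contribute at most 1 by
    [exp_moment_le1], and those above [y / 2] at most
    [expR (lam * y) * tail F (y / 2)].  In between, the exponential is at most
    [expR (lam * y / 2)], and [tail F (1 / lam)] exceeds [tail F y] by a power
    of [lam * y] only, which the other factor [expR (lam * y / 2)] absorbs. *)
Lemma truncated_exp_moment (a' : R) : 0 <= a' -> a < a' ->
  dominated_varying F -> exists K lam0, [/\ 0 <= K, 0 < lam0 &
    forall lam y, 0 < lam <= lam0 -> 0 < y -> 1 <= lam * y ->
    (\int[F]_z (if z - a' <= y then expR (lam * (z - a')) else 0)%:E <=
     (1 + K * (expR (lam * y) * tail F y))%:E)%E].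
Proof.
move=> a'0 aa' Fdom.
have [p [C [C0 HC]]] := tail_polynomial Fdom.
pose g z := z - a'.
have [intg Eg0] : F.-integrable setT (EFin \o g) /\ \int[F]_z g z < 0.
  have [] := integrable_affine 1 (- a').
  rewrite (_ : (fun z => 1 * z - a') = g); first by move=> ? ->; split=> //; lra.
  by apply/funext => z; rewrite /g mul1r.
have mg : measurable_fun setT g.
  by apply/measurable_EFinP; case/integrableP: intg.
have [lam0 [lam00 Hlam]] := exp_moment_le1 intg Eg0.
exists (C * 2 ^+ p + C * 2 ^+ p * p`!%:R), lam0.
split=> [||lam y /andP[lam_gt0 lamle] y0 s1] //.
  by rewrite addr_ge0// !mulr_ge0 ?exprn_ge0// ltW.
pose s := lam * y.
have s0 : 0 < s by rewrite /s; lra.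
have lamE : lam = s / y by rewrite /s mulfK// gt_eqF.
pose f1 z := if lam * g z <= 1 then expR (lam * g z) else 0.
have mlg : measurable_fun setT (fun z => lam * g z) by exact: measurable_funM.
have mf1 : measurable_fun setT f1.
  apply: measurable_fun_ifT => //; first exact: measurable_fun_ler.
  exact: measurableT_comp.
pose f2 z := expR (s / 2) * \1_[set z | y / s < z] z.
pose f3 z := expR s * \1_[set z | y / 2 < z] z.
have f1_ge0 z : 0 <= f1 z by rewrite /f1; case: ifP => // _; exact: expR_ge0.
have f2_ge0 z : 0 <= f2 z by rewrite mulr_ge0 ?expR_ge0// indicE.
have f3_ge0 z : 0 <= f3 z by rewrite mulr_ge0 ?expR_ge0// indicE.
have mind x : measurable_fun setT (\1_[set z : R | x < z] : R -> R).
  by apply: measurable_indic; exact: measurable_gt.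
have mf2 : measurable_fun setT f2 by exact: measurable_funM.
have mf3 : measurable_fun setT f3 by exact: measurable_funM.
have I1 : (\int[F]_z (f1 z)%:E <= 1)%E by apply: Hlam; rewrite lam_gt0.
have Iind c x : 0 <= c ->
    (\int[F]_z (c * \1_[set z | x < z] z)%:E = (c * tail F x)%:E)%E.
  move=> c0; under eq_integral do rewrite EFinM.
  rewrite ge0_integralZl//; last exact/measurable_EFinP.
  rewrite integral_indic//; last exact: measurable_gt.
  rewrite setIT EFinM tailE fineK// fin_num_measure//; exact: measurable_gt.
apply: (@le_trans _ _ (\int[F]_z ((f1 z)%:E + ((f2 z)%:E + (f3 z)%:E)))%E).
  apply: ge0_le_integral => //.
  - by move=> z _; rewrite lee_fin; case: ifP => // _; exact: expR_ge0.
  - apply/measurable_EFinP; apply: measurable_fun_ifT => //.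
      exact: measurable_fun_ler.
    exact: measurableT_comp.
  - under eq_fun do rewrite -!EFinD.
    apply/measurable_EFinP; apply: measurable_funD => //.
    exact: measurable_funD.
  move=> z _; rewrite -!EFinD lee_fin -/(g z).
  have [gy|_] := leP (g z) y; last by rewrite !addr_ge0.
  have := f2_ge0 z; have := f3_ge0 z; rewrite /f1.
  have [|lg1] := leP (lam * g z) 1; first by lra.
  have gz : g z <= z by rewrite /g; lra.
  have zs : y / s < z.
    apply: lt_le_trans gz; rewrite ltr_pdivrMr//.
    by move: lg1; rewrite lamE mulrAC ltr_pdivlMr// mul1r mulrC.
  have [zy|zy] := leP z (y / 2).
    move=> h3 _; rewrite /f2 indicE mem_set// mulr1 add0r.
    apply: (@le_trans _ _ (expR (s / 2))); last by rewrite lerDl.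
    rewrite ler_expR; apply: (@le_trans _ _ (lam * (y / 2))).
      by rewrite ler_pM2l//; lra.
    by rewrite mulrA.
  move=> _ h2; rewrite /f3 indicE mem_set// mulr1 add0r.
  apply: (@le_trans _ _ (expR s)); last by rewrite lerDr.
  by rewrite ler_expR ler_pM2l.
rewrite ge0_integralD//; last 4 first.
- by move=> z _; rewrite lee_fin.
- exact/measurable_EFinP.
- by move=> z _; rewrite -EFinD lee_fin addr_ge0.
- under eq_fun do rewrite -EFinD.
  by apply/measurable_EFinP; exact: measurable_funD.
rewrite ge0_integralD//; last 4 first.
- by move=> z _; rewrite lee_fin.
- exact/measurable_EFinP.
- by move=> z _; rewrite lee_fin.
- exact/measurable_EFinP.
rewrite /f2 /f3 !Iind ?expR_ge0// EFinD; apply: leeD => //.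
rewrite -EFinD lee_fin -/s; set ty := tail F y.
have ty0 : 0 <= ty := tail_ge0 F y.
have t2 : expR s * tail F (y / 2) <= C * 2 ^+ p * (expR s * ty).
  have := HC y 2 y0 ltac:(lra); rewrite -/ty => h.
  apply: (le_trans (ler_wpM2l (expR_ge0 s) h)).
  by rewrite le_eqVlt; apply/orP; left; apply/eqP; ring.
have ts : expR (s / 2) * tail F (y / s) <= C * 2 ^+ p * p`!%:R * (expR s * ty).
  have := HC y s y0 s1; rewrite -/ty => h.
  apply: (le_trans (ler_wpM2l (expR_ge0 _) h)).
  have s2 : 0 <= s / 2 by lra.
  have h2 := exprn_le_expR p s2.
  have -> : s ^+ p = 2 ^+ p * (s / 2) ^+ p.
    by rewrite -exprMn; congr (_ ^+ _); lra.
  have -> : expR s = expR (s / 2) * expR (s / 2).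
    by rewrite -expRD; congr expR; lra.
  rewrite [leLHS](_ : _ = (expR (s / 2) * C * 2 ^+ p * ty) * (s / 2) ^+ p).
    rewrite [leRHS](_ : _ = (expR (s / 2) * C * 2 ^+ p * ty) *
      (p`!%:R * expR (s / 2))); last by ring.
    by apply: ler_wpM2l => //; rewrite !mulr_ge0 ?expR_ge0 ?exprn_ge0// ltW.
  by ring.
rewrite mulrDl; lra.
Qed.

(** The exponent is the [lam] with [expR (lam * y) = 1 / (n * tail F y)], so
    that [truncated_exp_moment] gives [1 + K / n].  Two conditions hold
    for large [y]: [1 <= lam * y], because [y * tail F y] tends to 0 and [n] is
    at most of order [y]; and [lam <= lam0], by [tail_inv_le_expR]. *)
Lemma walk_upper_bound (a' kap : R) : 0 <= a' -> a < a' -> 0 < kap ->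
  dominated_varying F ->
  exists C y0, [/\ 0 < C, 0 < y0 & forall y n, y0 <= y -> (0 < n)%N ->
    n%:R <= kap * y ->
    fine (P [set w | exists2 k, (k <= n)%N &
                       k%:R * a' + y <= partial_sum xi k w])
    <= C * n%:R * tail F y].
Proof.
move=> a'0 aa' kap0 Fdom; have [F0 _] := Fdom.
have [K [lam0 [K0 lam00 moment]]] := truncated_exp_moment a'0 aa' Fdom.
have [|L HL] := mul_tail_small intF (e := expR (- 1) / kap).
  by rewrite divr_gt0// expR_gt0.
have [Y HY] := tail_inv_le_expR Fdom lam00.
exists (1 + expR K), (1 + `|L| + `|Y|).
split=> [||y n yy0 n0 nk]; first by have := expR_gt0 K; lra.
  by have := normr_ge0 L; have := normr_ge0 Y; lra.
have [y0 yL yY] : [/\ 0 < y, L <= y & Y <= y].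
  have := ler_norm L; have := ler_norm Y.
  by have := normr_ge0 L; have := normr_ge0 Y; split; lra.
have N0 : 0 < n%:R :> R by rewrite ltr0n.
have ty0 := F0 y; set ty := tail F y in ty0 *.
have nty0 : 0 < n%:R * ty by exact: mulr_gt0.
have ntyq : n%:R * ty <= expR (- 1).
  have t1 : ty <= fine (F [set z | y < `|z|]).
    rewrite /ty tailE; apply: fine_le_prob; first exact: measurable_gt.
      by apply: measurable_set_lt => //; exact: normr_measurable.
    by move=> z /= /lt_le_trans; apply; exact: ler_norm.
  apply: (@le_trans _ _ (kap * (y * ty))).
    by rewrite mulrA ler_wpM2r// ltW.
  rewrite mulrC -ler_pdivlMr//; apply: le_trans (HL _ yL).
  by rewrite ler_wpM2l// ltW.
pose s := - ln (n%:R * ty).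
have es : expR (- s) = n%:R * ty by rewrite opprK lnK.
have esV : expR s = (n%:R * ty)^-1 by rewrite -es expRN invrK.
have s1 : 1 <= s by rewrite -lerN2 -ler_expR es.
have slam : s <= lam0 * y.
  rewrite -ler_expR esV; apply: le_trans (HY _ yY).
  by rewrite lef_pV2 ?posrE// ler_peMl ?(ltW ty0)// ler1n.
pose lam := s / y.
have lam_gt0 : 0 < lam by rewrite divr_gt0//; lra.
have lamy : lam * y = s by rewrite divfK// gt_eqF.
have esty : expR s * ty = n%:R^-1.
  by rewrite esV invfM mulrVK// unitfE gt_eqF.
have mg : measurable_fun setT (fun z : R => z - a').
  by apply: measurable_funB => //; exact: measurable_id.
have phi1 : 1 <= 1 + K / n%:R by rewrite lerDl divr_ge0// ltW.
have max := exponential_maximal_bound xi_indep xi_distr (v := y) n mg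
  lam_gt0 y0 phi1.
have sumE k w : partial_sum (fun i => (fun z => z - a') \o xi i) k w =
    partial_sum xi k w - k%:R * a'.
  rewrite /partial_sum /= sumrB sumr_const_nat subSS subn0.
  by rewrite -[a' *+ k]mulr_natl.
rewrite (_ : [set w | _] = [set w | exists2 k, (k <= n)%N &
     y <= partial_sum (fun i => (fun z => z - a') \o xi i) k w]); last first.
  by apply/seteqP; split=> w /= [k kn h]; exists k => //; move: h;
    rewrite sumE lerBrDl.
apply: (le_trans (max _)).
  rewrite -esty -lamy; apply: moment => //; last by rewrite lamy.
  by rewrite lam_gt0 /lam ler_pdivrMr.
rewrite lamy es.
have le1 : fine (F [set z | y < z - a']) <= ty.
  rewrite /ty tailE; apply: fine_le_prob.
  - exact: measurable_set_lt.
  - exact: measurable_gt.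
  - by move=> z /= /lt_le_trans; apply; lra.
have phin : (1 + K / n%:R) ^+ n <= expR K.
  have -> : expR K = expR (K / n%:R) ^+ n.
    by rewrite -expRM_natl mulrC divfK// gt_eqF.
  rewrite lerXn2r ?nnegrE ?expR_ge0// ?expR_ge1Dx//.
  by apply: le_trans phi1.
rewrite [leRHS](_ : _ = n%:R * ty + expR K * (n%:R * ty)); last by ring.
apply: lerD.
  by rewrite ler_wpM2l.
by rewrite ler_wpM2r// ltW.
Qed.

End Walk.

(** * One big jump among finitely many steps *)

Section FixedTime.
Context d (T : measurableType d) (R : realType) (P : probability T R).
Variables (F : probability R R) (xi : nat -> {RV P >-> R}).
Hypothesis xi_indep : mutually_independent xi.
Hypothesis xi_distr : forall (n : nat) (A : set R), measurable A ->
  distribution P (xi n) A = F A.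
Hypothesis intF : F.-integrable setT (EFin \o id).

Lemma measurable_xi_preimage i (B : set R) : measurable B ->
  measurable (xi i @^-1` B).
Proof.
by move=> mB; rewrite -[X in measurable X]setTI; exact: measurable_funP.
Qed.

Lemma measurable_abs_gt (K : R) : measurable [set z : R | K < `|z|].
Proof. by apply: measurable_set_lt => //; exact: normr_measurable. Qed.

Lemma measurable_running_max_gt n x :
  measurable [set w | x < running_max xi n w].
Proof. by apply: measurable_set_lt => //; exact: measurable_running_max. Qed.

Lemma measurable_partial_sum_gt n x :
  measurable [set w | x < partial_sum xi n w].
Proof. by apply: measurable_set_lt => //; exact: measurable_walk. Qed.

Lemma abs_gt_small (e : R) : 0 < e ->
  exists K, 0 < K /\ fine (F [set z | K < `|z|]) <= e.
Proof.
move=> /(mul_tail_small intF)[L HL]; exists (1 + `|L|).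
have K1 : 1 <= 1 + `|L| by rewrite lerDl.
split; first by lra.
apply: le_trans (HL (1 + `|L|) _); last by have := ler_norm L; lra.
by rewrite ler_peMl// fine_ge0.
Qed.

Lemma pair_indep i j (B C : set R) : i != j -> measurable B -> measurable C ->
  P (xi i @^-1` B `&` xi j @^-1` C) = (F B * F C)%E.
Proof.
move=> ij mB mC; pose D k := if k == i then B else C.
have mD k : measurable (D k) by rewrite /D; case: ifP.
have := xi_indep [fset i; j]%fset mD.
rewrite set_fsetU !set_fset1 bigcap_setU !bigcap_set1 big_fsetU1 ?inE//=.
rewrite big_seq_fset1 /D eqxx eq_sym (negbTE ij) => ->.
by rewrite -(xi_distr i mB) -(xi_distr j mC).
Qed.

(** If the maximum exceeds [x], some step exceeds [x / n].  Either another step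
    exceeds [K], or all the others are at most [K] and that step exceeds
    [x - n * K]. *)
Lemma running_max_gt_bound n (x K : R) : 0 <= x -> 0 <= K ->
  fine (P [set w | x < running_max xi n w]) <=
  n%:R * tail F (x - n%:R * K) +
  n%:R * (n%:R * (tail F (x / n%:R) * tail F K)).
Proof.
move=> x0 K0.
pose A i := [set w | x - n%:R * K < xi i w].
pose B i j := if i == j then set0 else
  [set w | x / n%:R < xi i w] `&` [set w | K < xi j w].
pose U := \bigcup_(i in [set i | (0 < i <= n)%N]) A i.
pose V i := \bigcup_(j in [set i | (0 < i <= n)%N]) B i j.
pose W := \bigcup_(i in [set i | (0 < i <= n)%N]) V i.
have mgt i c : measurable [set w | c < xi i w].
  exact: (measurable_xi_preimage i (measurable_gt c)).
have mB i j : measurable (B i j).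
  by rewrite /B; case: ifP => // _; exact: measurableI.
have mV i : measurable (V i) by exact: bigcup_measurable.
have mU : measurable U by apply: bigcup_measurable => i _; exact: mgt.
have mW : measurable W by exact: bigcup_measurable.
have sub : [set w | x < running_max xi n w] `<=` U `|` W.
  move=> w /= /running_max_gt[k kn xk].
  have [|nU] := pselect (U w); [by left|right].
  apply: contrapT => nW.
  have hU i : (0 < i <= n)%N -> xi i w <= x - n%:R * K.
    by move=> i0n; rewrite leNgt; apply/negP => h; apply: nU; exists i.
  have hW i j : (0 < i <= n)%N -> (0 < j <= n)%N -> i != j ->
      x / n%:R < xi i w -> xi j w <= K.
    move=> i0n j0n ij xin; rewrite leNgt; apply/negP => h; apply: nW.
    by exists i => //; exists j => //; rewrite /B (negbTE ij).
  have [j j0k xj] : exists2 j, (0 < j <= k)%N & x / n%:R < xi j w.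
    apply: contrapT => nj; have : partial_sum xi k w <= x; last by lra.
    apply: (@le_trans _ _ (\sum_(1 <= i < k.+1) (x / n%:R))).
      rewrite /partial_sum; apply: ler_sum_nat => i ik.
      by rewrite leNgt; apply/negP => h; apply: nj; exists i.
    rewrite sumr_const_nat subSS subn0 -[_ *+ k]mulr_natr.
    have [n0|n0] := posnP n.
      by move: kn; rewrite n0 leqn0 => /eqP ->; rewrite mulr0.
    rewrite mulrAC ler_pdivrMr ?ltr0n//.
    by rewrite ler_wpM2l// ler_nat.
  have : partial_sum xi k w <= x; last by lra.
  rewrite /partial_sum (@bigD1_seq _ _ _ _ _ j)/= ?iota_uniq//; last first.
    by rewrite mem_index_iota ltnS.
  apply: (@le_trans _ _ (x - n%:R * K + \sum_(1 <= i < k.+1 | i != j) K)).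
    apply: lerD; first by apply: hU; lia.
    rewrite big_seq_cond [leRHS]big_seq_cond; apply: ler_sum => i.
    rewrite mem_index_iota => /andP[ik ij].
    by apply: (hW j i) => //; [lia|lia|rewrite eq_sym].
  have : \sum_(1 <= i < k.+1 | i != j) K <= n%:R * K.
    rewrite big_mkcond; apply: (@le_trans _ _ (\sum_(1 <= i < k.+1) K)).
      by apply: ler_sum => i _; case: ifP.
    rewrite sumr_const_nat subSS subn0 -[_ *+ k]mulr_natl.
    by rewrite ler_wpM2r// ler_nat.
  lra.
apply: (le_trans (fine_le_prob P (measurable_running_max_gt n x) _ sub)).
  exact: measurableU.
apply: (le_trans (fine_probU_le P mU mW)); apply: lerD.
  apply: (le_trans (fine_prob_bigcup_le P n (fun i => mgt i _))).
  apply: sum_nat_le => i _.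
  by rewrite tailE -(xi_distr i (measurable_gt _)).
apply: (le_trans (fine_prob_bigcup_le P n mV)); apply: sum_nat_le => i _.
apply: (le_trans (fine_prob_bigcup_le P n (mB i))); apply: sum_nat_le => j _.
rewrite /B; case: (altP (i =P j)) => [_|ij].
  by rewrite measure0 mulr_ge0// tail_ge0.
have -> : P ([set w | x / n%:R < xi i w] `&` [set w | K < xi j w]) =
    (F [set z | x / n%:R < z]%R * F [set z | K < z]%R)%E.
  exact: (pair_indep ij (measurable_gt _) (measurable_gt _)).
by rewrite !tailE fineM// fin_num_measure//; exact: measurable_gt.
Qed.

Lemma long_tailed_near (y e : R) : long_tailed F -> 0 < e ->
  \forall x \near +oo, `|tail F (x + y) - tail F x| <= e * tail F x.
Proof.
move=> [F0 /(_ y) /cvgrPdist_le /(_ e)] h e0; have {}h := h e0.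
near=> x; have : `|1 - tail F (x + y) / tail F x| <= e by near: x.
have t0 := F0 x.
rewrite -{1}(divff (lt0r_neq0 t0)) -mulrBl normrM normfV (ger0_norm (ltW t0)).
by rewrite ler_pdivrMr// distrC.
Unshelve. all: by end_near. Qed.

(** In [running_max_gt_bound] the first term is asymptotic to [n * tail F x]
    because [F] is long-tailed.  In the second, [tail F (x / n)] is at most a
    multiple of [tail F x] that depends on [n] only, and [tail F K] is made
    small against it by the choice of [K]. *)
Lemma running_max_fixed_upper n (e : R) : long_tailed F -> dominated_varying F ->
  0 < e -> \forall x \near +oo,
  fine (P [set w | x < running_max xi n w]) <= (1 + e) * (n%:R * tail F x).
Proof.
move=> Flong Fdom e0; have [p [C [C0 HC]]] := tail_polynomial Fdom.
have [|K [K0 HK]] := @abs_gt_small (e / 2 / (C * n.+1%:R ^+ p.+1)).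
  by rewrite divr_gt0// ?divr_gt0// mulr_gt0// exprn_gt0.
near=> x.
have x0 : 0 < x by near: x; exact: nbhs_pinfty_gt.
have h1 : `|tail F (x + - (n%:R * K)) - tail F x| <= e / 2 * tail F x.
  by near: x; apply: long_tailed_near => //; rewrite divr_gt0.
apply: (le_trans (@running_max_gt_bound n x K (ltW x0) (ltW K0))).
have [n0|n0] := posnP n; first by rewrite n0 !mul0r mulr0 addr0.
have N1 : 1 <= n%:R :> R by rewrite ler1n.
have t0 : 0 <= tail F x := tail_ge0 F x.
have tK : tail F K <= e / 2 / (C * n.+1%:R ^+ p.+1).
  apply: le_trans HK; rewrite tailE; apply: fine_le_prob.
  - exact: measurable_gt.
  - exact: measurable_abs_gt.
  - by move=> z /= /lt_le_trans; apply; exact: ler_norm.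
have h2 : n%:R * (tail F (x / n%:R) * tail F K) <= e / 2 * tail F x.
  have h3 := HC x n%:R x0 N1.
  apply: (@le_trans _ _ (n%:R * ((C * n%:R ^+ p * tail F x) *
      (e / 2 / (C * n.+1%:R ^+ p.+1))))).
    by rewrite ler_wpM2l// ler_pM// tail_ge0.
  have D0 : 0 < C * n.+1%:R ^+ p.+1 by rewrite mulr_gt0// exprn_gt0.
  rewrite !mulrA ler_pdivrMr//.
  rewrite [leLHS](_ : _ = (e / 2 * tail F x * C) * n%:R ^+ p.+1); last first.
    by rewrite exprS; ring.
  rewrite [leRHS](_ : _ = (e / 2 * tail F x * C) * n.+1%:R ^+ p.+1); last first.
    by ring.
  apply: ler_wpM2l.
    by rewrite !mulr_ge0// ltW// divr_gt0.
  by rewrite lerXn2r ?nnegrE// ler_nat.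
have h4 : tail F (x - n%:R * K) <= (1 + e / 2) * tail F x.
  by move: h1; rewrite ler_norml => /andP[_]; lra.
have N0 : 0 <= n%:R :> R by lra.
have := ler_wpM2l N0 h2; have := ler_wpM2l N0 h4.
lra.
Unshelve. all: by end_near. Qed.

(** Independence gives a product of one tail and [n - 1] factors
    [1 - P (|step| > K)], bounded below by Bernoulli's inequality. *)
Lemma one_big_jump_prob n i (x K : R) : (0 < i <= n)%N -> 0 <= K ->
  tail F (x + n%:R * K) * (1 - n%:R * fine (F [set z | K < `|z|])) <=
  fine (P (\bigcap_(j in [set j | (0 < j <= n)%N])
    xi j @^-1` (if j == i then [set z | x + n%:R * K < z]
                else [set z | `|z| <= K]))).
Proof.
move=> i0n K0.
pose B j : set R := if j == i then [set z | x + n%:R * K < z]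
                else [set z | `|z| <= K].
have mle : measurable [set z : R | `|z| <= K].
  by apply: measurable_set_le => //; exact: normr_measurable.
have mB j : measurable (B j).
  by rewrite /B; case: ifP => // _; exact: measurable_gt.
pose J := [fset j in iota 1 n]%fset.
have JE j : (j \in J) = (0 < j <= n)%N by rewrite !inE mem_iota; lia.
have -> : \bigcap_(j in [set j | (0 < j <= n)%N]) xi j @^-1` B j =
    \bigcap_(j in [set` J]) xi j @^-1` B j.
  by apply: eq_bigcap => //; split=> j /=; rewrite JE.
rewrite xi_indep//.
have FB j : P (xi j @^-1` B j) = (fine (F (B j)))%:E.
  rewrite fineK ?fin_num_measure// -(xi_distr j (mB j)) //.
rewrite (eq_bigr _ (fun j _ => FB j)) prodEFin /=.
rewrite (bigD1_seq i)/= ?fset_uniq ?JE//.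
rewrite {1}/B eqxx -tailE; apply: ler_wpM2l; first exact: tail_ge0.
pose t := fine (F [set z | K < `|z|]).
have tle : fine (F [set z | `|z| <= K]) = 1 - t.
  have -> : [set z : R | `|z| <= K] = ~` [set z | K < `|z|].
    by apply/seteqP; split=> z /=; rewrite leNgt => /negP.
  rewrite probability_setC; last exact: measurable_abs_gt.
  by rewrite fineB// fin_num_measure//; exact: measurable_abs_gt.
have t01 : 0 <= t <= 1.
  rewrite fine_ge0//=; have : 0 <= 1 - t by rewrite -tle fine_ge0.
  lra.
apply: (le_trans (bernoulli_le n t01)).
rewrite (eq_bigr (fun=> 1 - t)); last first.
  by move=> j ji; rewrite /B (negbTE ji).
rewrite big_const_seq iter_mulr_1; apply: ler_wiXn2l; try lra.
apply: (leq_trans (count_size _ _)).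
by rewrite (card_fseq (iota 1 n)) (leq_trans (size_undup _))// size_iota.
Qed.

(** The events that the [i]-th step exceeds [x + n * K] and all the others stay
    in [[-K, K]] are disjoint and each forces the sum above [x]. *)
Lemma partial_sum_fixed_lower n (e : R) : long_tailed F -> 0 < e < 1 ->
  \forall x \near +oo,
  (1 - e) * (n%:R * tail F x) <= fine (P [set w | x < partial_sum xi n w]).
Proof.
move=> Flong /andP[e0 e1].
have [|K [K0 HK]] := @abs_gt_small (e / 2 / n.+1%:R).
  by rewrite divr_gt0// divr_gt0.
near=> x.
have x0 : 0 < x by near: x; exact: nbhs_pinfty_gt.
have h1 : `|tail F (x + n%:R * K) - tail F x| <= e / 2 * tail F x.
  by near: x; apply: long_tailed_near => //; rewrite divr_gt0.
pose B (i j : nat) : set R := if j == i then [set z | x + n%:R * K < z]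
                      else [set z | `|z| <= K].
pose E (i : 'I_n) := \bigcap_(j in [set j | (0 < j <= n)%N]) xi j @^-1` B i.+1 j.
have mle : measurable [set z : R | `|z| <= K].
  by apply: measurable_set_le => //; exact: normr_measurable.
have mB i j : measurable (B i j).
  by rewrite /B; case: ifP => // _; exact: measurable_gt.
have mE i : measurable (E i).
  by apply: bigcap_measurableType => j _; exact: measurable_xi_preimage.
have mU : measurable (\big[setU/set0]_(i < n) E i).
  exact: bigsetU_measurable.
have trivE : trivIset setT E.
  apply/trivIsetP => i j _ _ ij; apply/seteqP; split=> // w [/= Ei Ej].
  have ii : (0 < i.+1 <= n)%N by rewrite ltn_ord.
  have := Ei i.+1 ii; have := Ej i.+1 ii; rewrite /B /= eqxx eqSS.
  rewrite (inj_eq val_inj) (negbTE ij) => /= h h'.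
  have N1 : 1 <= n%:R :> R by rewrite ler1n (leq_trans _ (ltn_ord i)).
  have : K <= n%:R * K by rewrite ler_peMl// ltW.
  by have := ler_norm (xi i.+1 w); lra.
have sub : \big[setU/set0]_(i < n) E i `<=` [set w | x < partial_sum xi n w].
  apply: (big_ind (fun A => A `<=` [set w | x < partial_sum xi n w])) => //.
    by move=> A1 A2 h1A h2A w [/h1A|/h2A].
  move=> i _ w Ei /=.
  have ii : (0 < i.+1 <= n)%N by rewrite ltn_ord.
  rewrite /partial_sum (@bigD1_seq _ _ _ _ _ i.+1)/= ?iota_uniq//; last first.
    by rewrite mem_index_iota.
  have xi1 : x + n%:R * K < xi i.+1 w.
    by have := Ei i.+1 ii; rewrite /B /= eqxx.
  have : - (n%:R * K) <= \sum_(1 <= j < n.+1 | j != i.+1) xi j w.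
    apply: (@le_trans _ _ (\sum_(1 <= j < n.+1 | j != i.+1) (- K))).
      rewrite sumrN lerN2 big_mkcond.
      apply: (@le_trans _ _ (\sum_(1 <= j < n.+1) K)).
        by apply: ler_sum => j _; case: ifP => // _; exact: ltW.
      by rewrite sumr_const_nat subSS subn0 -[_ *+ n]mulr_natl.
    rewrite big_seq_cond [leRHS]big_seq_cond; apply: ler_sum => j.
    rewrite mem_index_iota ltnS => /andP[jn ji].
    have := Ei j jn; rewrite /B /= (negbTE ji) /= => hj.
    by move: hj; rewrite ler_norml => /andP[].
  lra.
apply: (@le_trans _ _ (fine (P (\big[setU/set0]_(i < n) E i)))); last first.
  by apply: fine_le_prob => //; exact: measurable_partial_sum_gt.
rewrite measure_semi_additive_ord// (eq_bigr (fun i => (fine (P (E i)))%:E)).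
  2: by move=> i _; rewrite fineK// fin_num_measure.
rewrite sumEFin /=.
pose t := fine (F [set z | K < `|z|]).
apply: (@le_trans _ _ (\sum_(i < n) (tail F (x + n%:R * K) * (1 - n%:R * t)))).
  rewrite sumr_const card_ord -[leRHS]mulr_natl [leLHS]mulrCA ler_wpM2l//.
  have t0 : 0 <= tail F x := tail_ge0 F x.
  have h2 : (1 - e / 2) * tail F x <= tail F (x + n%:R * K).
    by move: h1; rewrite ler_norml => /andP[+ _]; lra.
  have h3 : 1 - e / 2 <= 1 - n%:R * t.
    rewrite lerB//; apply: (@le_trans _ _ (n%:R * (e / 2 / n.+1%:R))).
      by rewrite ler_wpM2l.
    rewrite mulrCA ler_piMr//; first by lra.
    by rewrite ler_pdivrMr// mul1r ler_nat.
  apply: (@le_trans _ _ ((1 - e / 2) * tail F x * (1 - e / 2))).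
    by nra.
  apply: ler_pM => //; try lra.
  by rewrite mulr_ge0//; lra.
apply: ler_sum => i _; apply: one_big_jump_prob; last exact: ltW.
by rewrite ltn_ord.
Unshelve. all: by end_near. Qed.

End FixedTime.

(** * The level compared with the drift *)

Section AllTimes.
Context d (T : measurableType d) (R : realType) (P : probability T R).
Variables (F : probability R R) (xi : nat -> {RV P >-> R}).
Hypothesis xi_indep : mutually_independent xi.
Hypothesis xi_distr : forall (n : nat) (A : set R), measurable A ->
  distribution P (xi n) A = F A.
Hypothesis intF : F.-integrable setT (EFin \o id).
Variable a : R.
Hypothesis meanF : \int[F]_z z = a.
Hypothesis a0 : 0 < a.

(** Apply [walk_upper_bound] with [a' = a * (1 + e)] and [y = e ^ 2 * x]: for
    [k <= n] we have [k * a' <= (1 - e) * (1 + e) * x = x - y]. *)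
Lemma running_max_bound_below_drift (e : R) : dominated_varying F -> 0 < e < 1 ->
  exists2 C, 0 < C & \forall x \near +oo, forall n, (0 < n)%N ->
    n%:R <= (1 - e) * (x / a) ->
    fine (P [set w | x < running_max xi n w]) <= C * (n%:R * tail F x).
Proof.
move=> Fdom /andP[e0 e1].
have a'0 : 0 <= a * (1 + e) by rewrite mulr_ge0 ?(ltW a0)// addr_ge0 ?ltW.
have aa' : \int[F]_z z < a * (1 + e) by rewrite meanF ltr_pMr//; lra.
have e2 : 0 < e ^+ 2 by rewrite exprn_gt0.
have kap0 : 0 < (a * e ^+ 2)^-1 by rewrite invr_gt0 mulr_gt0.
have [C [y0 [C0 y00 HC]]] :=
  walk_upper_bound xi_indep xi_distr intF a'0 aa' kap0 Fdom.
have [p [D [D0 HD]]] := tail_polynomial Fdom.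
pose u := (e ^+ 2)^-1.
have u1 : 1 <= u by rewrite invf_ge1// expr_le1// ltW.
exists (C * (D * u ^+ p)).
  by rewrite !mulr_gt0// exprn_gt0//; lra.
near=> x => n n0 nx.
have x0 : 0 < x by near: x; apply: nbhs_pinfty_gt; rewrite num_real.
have yx : y0 <= x / u.
  rewrite ler_pdivlMr; last by lra.
  by near: x; apply: nbhs_pinfty_ge; rewrite num_real.
have xuE : x / u = e ^+ 2 * x by rewrite /u invrK mulrC.
have nxa : n%:R <= x / a.
  apply: (le_trans nx); rewrite ler_piMl ?divr_ge0// ltW//; lra.
have h := HC (x / u) n yx n0.
apply: (@le_trans _ _ (C * n%:R * tail F (x / u))); last first.
  have h2 := HD x u x0 u1.
  rewrite [leRHS](_ : _ = C * n%:R * (D * u ^+ p * tail F x)); last by ring.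
  by rewrite ler_wpM2l// mulr_ge0// ltW.
apply: le_trans (h _); last first.
  rewrite xuE [leRHS](_ : _ = x / a)//.
  by field; rewrite !gt_eqF.
apply: fine_le_prob.
- exact: measurable_running_max_gt.
- apply: (measurable_exists_leq (A := fun k =>
    [set w | k%:R * (a * (1 + e)) + x / u <= partial_sum xi k w])) => k.
  by apply: measurable_set_le => //; exact: measurable_walk.
move=> w /= /running_max_gt[k kn xk]; exists k => //.
have kn' : k%:R <= n%:R :> R by rewrite ler_nat.
have ka : k%:R * a <= (1 - e) * x.
  rewrite -ler_pdivlMr//; apply: (le_trans kn'); apply: (le_trans nx).
  by rewrite mulrA.
rewrite xuE; apply: ltW; apply: le_lt_trans xk.
have : k%:R * a * (1 + e) <= (1 - e) * x * (1 + e) by rewrite ler_wpM2r//; lra.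
rewrite expr2; nra.
Unshelve. all: by end_near. Qed.

(** This is [walk_lower_lln] with [b = a * (1 - e)], since [b * n > x]. *)
Lemma partial_sum_lower_above_drift (e c : R) : 0 < e < 1 -> 0 < c ->
  \forall x \near +oo, forall n, x / (a * (1 - e)) < n%:R ->
    1 - c <= fine (P [set w | x < partial_sum xi n w]).
Proof.
move=> /andP[e0 e1] c0.
have ba : a * (1 - e) < \int[F]_z z by rewrite meanF gtr_pMr//; lra.
have b0 : 0 < a * (1 - e) by rewrite mulr_gt0//; lra.
have [n0 Hn] := walk_lower_lln xi_indep xi_distr intF ba c0.
near=> x => n xn.
have nn0 : (n0 <= n)%N.
  rewrite -(ler_nat R); apply: ltW; apply: le_lt_trans xn.
  by rewrite ler_pdivlMr.
have mle : measurable [set w | partial_sum xi n w <= a * (1 - e) * n%:R].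
  by apply: measurable_set_le => //; exact: measurable_walk.
have : fine (P (~` [set w | partial_sum xi n w <= a * (1 - e) * n%:R])) <=
    fine (P [set w | x < partial_sum xi n w]).
  apply: fine_le_prob.
  - exact: measurableC.
  - exact: measurable_partial_sum_gt.
  - move=> w /= /negP; rewrite -ltNge; apply: lt_trans.
    by rewrite mulrC -ltr_pdivrMr.
apply: le_trans; rewrite probability_setC// fineB//; last first.
  exact: fin_num_measure.
by rewrite /= lerB// Hn.
Unshelve. all: by end_near. Qed.

End AllTimes.

(** * Asymptotic comparison *)

Section Asymptotics.
Context (R : realType).

(** The double limit in the definition is unfolded into a single [e] that
    works for all large [x]. *)
Lemma irv_ratio (G : probability R R) (c : R) :
  intermediate_regularly_varying G -> 0 < c ->
  exists2 e, 0 < e < 1 & \forall x \near +oo,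
    tail G ((1 - e) * x) <= (1 + c) * tail G x.
Proof.
move=> [G0 h] c0.
have N : nbhs (1%:E : \bar R) [set y | (y < (1 + c)%:E)%E].
  by apply: (@nbhs_open_ereal_lt _ 1 (fun r => r + c)); rewrite ltrDl.
have {}h := h _ N.
have [e []] : exists e : R, [/\ 0 < e, e < 1 &
   (limf_esup (fun x : R => (tail G ((1 - e) * x) / tail G x)%:E) +oo%R
   < (1 + c)%:E)%E].
  apply: (@filter_ex _ (0 : R)^'+); near=> e; split.
  - by near: e; exact: nbhs_right_gt.
  - by near: e; exact: nbhs_right_lt.
  - by near: e; exact: h.
move=> e0 e1 /ereal_inf_lt[_ [V FV <-] ltV].
exists e; first by rewrite e0.
move: FV; apply: filterS => x Vx.
have := le_lt_trans (ereal_sup_ubound (ex_intro2 _ _ x Vx erefl)) ltV.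
by rewrite lte_fin => /ltW; rewrite ler_pdivrMr.
Unshelve. all: by end_near. Qed.

Lemma near_pinfty_scale (P : R -> Prop) (k : R) : 0 < k ->
  (\forall x \near +oo, P x) -> \forall x \near +oo, P (x / k).
Proof.
move=> k0 [M [_ MP]]; near=> x; apply: MP; rewrite ltr_pdivlMr//.
by near: x; apply: nbhs_pinfty_gt; rewrite num_real.
Unshelve. all: by end_near. Qed.

(** The hypothesis [f <= g] supplies the two missing halves of the sandwich of
    [f] and [g] between multiples of [h]. *)
Lemma asymp_equiv_sandwich (f g h : R -> R) :
  (\forall x \near +oo, 0 < h x) -> (forall x, f x <= g x) ->
  (forall e, 0 < e < 1 -> \forall x \near +oo, (1 - e) * h x <= f x) ->
  (forall e, 0 < e < 1 -> \forall x \near +oo, g x <= (1 + e) * h x) ->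
  asymp_equiv f g /\ asymp_equiv g h.
Proof.
move=> h0 fg fl gu; split; apply/cvgrPdist_le => e e0.
  pose c := Num.min (e / 2) (1 / 2).
  have c01 : 0 < c < 1.
    rewrite /c lt_min gt_min; apply/andP; split; [apply/andP; split|].
    1,2: by lra.
    by apply/orP; right; lra.
  have ce : c <= e / 2 by rewrite /c ge_min lexx.
  have c0 : 0 < c by case/andP: c01.
  have c1 : c < 1 by case/andP: c01.
  near=> x.
  have hx : 0 < h x by near: x.
  have fx : (1 - c) * h x <= f x by near: x; exact: fl.
  have gx : g x <= (1 + c) * h x by near: x; exact: gu.
  have fgx := fg x.
  have ch : 0 < (1 - c) * h x by rewrite mulr_gt0//; lra.
  have g0 : 0 < g x by lra.
  rewrite -{1}(divff (lt0r_neq0 g0)) -mulrBl normrM normfV (ger0_norm (ltW g0)).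
  rewrite ler_pdivrMr// ger0_norm ?subr_ge0//.
  nra.
pose c := Num.min e (1 / 2).
have c01 : 0 < c < 1.
  by rewrite /c lt_min gt_min e0 /=; apply/andP; split; [|apply/orP; right]; lra.
have ce : c <= e by rewrite /c ge_min lexx.
near=> x.
have hx : 0 < h x by near: x.
have fx : (1 - c) * h x <= f x by near: x; exact: fl.
have gx : g x <= (1 + c) * h x by near: x; exact: gu.
have fgx := fg x.
rewrite -{1}(divff (lt0r_neq0 hx)) -mulrBl normrM normfV (ger0_norm (ltW hx)).
rewrite ler_pdivrMr// ler_norml; apply/andP; split; nra.
Unshelve. all: by end_near. Qed.

End Asymptotics.

Lemma near_forall_leq (R : realType) (Q : nat -> R -> Prop) N :
  (forall n, \forall x \near +oo, Q n x) ->
  \forall x \near +oo, forall n, (n <= N)%N -> Q n x.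
Proof.
move=> nQ; elim: N => [|N IH].
  near=> x => n; rewrite leqn0 => /eqP ->.
  by near: x; exact: nQ.
near=> x => n; rewrite leq_eqVlt => /orP[/eqP ->|nN].
  by near: x; exact: nQ.
have : forall n, (n <= N)%N -> Q n x by near: x.
exact.
Unshelve. all: by end_near. Qed.

(** * The walk at a random index *)

Section Mixture.
Context d (T : measurableType d) (R : realType) (P : probability T R).
Variables (tau : {RV P >-> nat}) (I : Type) (X : I -> {RV P >-> R}).
Hypothesis tau_indep : independent_of_family tau X.

Lemma sigma_family_measurable : sigma_family X `<=` measurable.
Proof.
apply: smallest_sub; first exact: sigma_algebra_measurable.
move=> A [i _ [B mB <-]]; exact: measurable_funP.
Qed.

Lemma measurable_tau (A : set nat) : measurable (tau @^-1` A).
Proof. by rewrite -[X in measurable X]setTI; exact: measurable_funP. Qed.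

Lemma measurable_comp_tau (s : nat -> R) : measurable_fun setT (s \o tau).
Proof. exact: measurableT_comp. Qed.

Lemma random_index_bigcup (E : nat -> set T) :
  [set w | E (tau w) w] = \bigcup_n (tau @^-1` [set n] `&` E n).
Proof.
by apply/seteqP; split=> w /=; [move=> Ew; exists (tau w)|move=> [n _ [/= ->]]].
Qed.

Lemma measurable_at_random_index (E : nat -> set T) :
  (forall n, measurable (E n)) -> measurable [set w | E (tau w) w].
Proof.
move=> mE; rewrite random_index_bigcup; apply: bigcup_measurable => n _.
by apply: measurableI => //; exact: measurable_tau.
Qed.

(** Split according to the value of [tau]; independence factors each piece. *)
Lemma prob_at_random_index (E : nat -> set T) :
  (forall n, sigma_family X (E n)) ->
  (P [set w | E (tau w) w] = \int[P]_w (fine (P (E (tau w))))%:E)%E.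
Proof.
move=> sE.
have mE n : measurable (E n) by exact: sigma_family_measurable.
pose A n := tau @^-1` [set n].
have mA n : measurable (A n) by exact: measurable_tau.
have triv : trivIset setT A.
  apply/trivIsetP => i j _ _ /eqP ij; apply/seteqP; split=> // w [wi wj].
  by apply: ij; exact: etrans (esym wi) wj.
rewrite random_index_bigcup -/A.
have -> : P (\bigcup_n (A n `&` E n)) = (\sum_(0 <= n <oo) P (A n `&` E n))%E.
  rewrite measure_bigcup//.
  - by apply: eq_eseriesl => // i; rewrite in_setT.
  - by move=> n _; exact: measurableI.
  - exact: trivIset_setIr.
have AT : \bigcup_n A n = setT.
  by apply/seteqP; split=> // w _; exists (tau w).
rewrite -[X in (\int[P]_(_ in X) _)%E]AT ge0_integral_bigcup//; last 2 first.
- rewrite AT; apply/measurable_EFinP.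
  exact: (measurable_comp_tau (fun n => fine (P (E n)))).
- by move=> w _; rewrite lee_fin fine_ge0.
apply: eq_eseriesr => n _.
rewrite tau_indep//.
rewrite (eq_integral (cst (fine (P (E n)))%:E)); last first.
  by move=> w; rewrite inE => /= ->.
have fE : P (E n) \is a fin_num by exact: fin_num_measure.
by rewrite (integral_cst P (mA n)) (fineK fE) muleC.
Qed.

End Mixture.

Section RandomIndex.
Context d (T : measurableType d) (R : realType) (P : probability T R).
Variables (F : probability R R) (xi : nat -> {RV P >-> R}).
Variable tau : {RV P >-> nat}.
Hypothesis xi_indep : mutually_independent xi.
Hypothesis xi_distr : forall (n : nat) (A : set R), measurable A ->
  distribution P (xi n) A = F A.
Hypothesis intF : F.-integrable setT (EFin \o id).
Variable a : R.
Hypothesis meanF : \int[F]_z z = a.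
Hypothesis a0 : 0 < a.
Hypothesis tau_int : P.-integrable setT (EFin \o natr_rv tau).
Hypothesis tau_indep : independent_of_family tau (fun n => xi n.+1).
Hypothesis tau_irv :
  intermediate_regularly_varying (distribution P (natr_rv tau)).
Hypothesis F_long : long_tailed F.
Hypothesis F_dom : dominated_varying F.

Let A := \int[P]_w natr_rv tau w.
Let H x := A * tail F x + fine (P [set w | x / a < (tau w)%:R]).

Lemma tail_natr_rv x :
  tail (distribution P (natr_rv tau)) x = fine (P [set w | x < (tau w)%:R]).
Proof. by rewrite tailE. Qed.

Lemma measurable_natr_rv_gt (x : R) : measurable [set w | x < natr_rv tau w].
Proof. by apply: measurable_set_lt => //; exact: measurable_natr_rv. Qed.

Lemma tau_mean_gt0 : 0 < A.
Proof.
have [G0 _] := tau_irv; have := G0 0; rewrite tail_natr_rv => /lt_le_trans; apply.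
have mA := measurable_natr_rv_gt 0.
have -> : fine (P [set w | 0 < (tau w)%:R :> R]) =
    \int[P]_w \1_[set w | 0 < natr_rv tau w] w.
  by rewrite /Rintegral integral_indic// setIT.
apply: le_Rintegral => //; first exact: integrable_indic.
move=> w _; rewrite indicE; case: (boolP (_ \in _)) => [|_]; last first.
  by rewrite /natr_rv.
by rewrite inE /= /natr_rv ltr0n ler1n.
Qed.

(** Measurability has to hold in the sigma-algebra generated by the steps
    numbered from 1, the one from which [tau] is independent. *)
Lemma walk_events_sigma_family n (x : R) :
  sigma_family (fun i => xi i.+1) [set w | x < partial_sum xi n w] /\
  sigma_family (fun i => xi i.+1) [set w | x < running_max xi n w].
Proof.
pose T' := g_sigma_algebraType
  (\bigcup_i preimage_set_system setT (xi i.+1) measurable).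
have mxi i : (0 < i)%N -> @measurable_fun _ _ T' R setT (xi i).
  case: i => // i _ _ B mB; apply: sub_sigma_algebra.
  by exists i => //; exists B.
split.
  apply: (@measurable_set_lt _ T' R (cst x)) => //.
  by apply: measurable_partial_sum => i /andP[i0 _]; exact: mxi.
apply: (@measurable_set_lt _ T' R (cst x)) => //.
exact: measurable_running_max.
Qed.

Lemma prob_partial_sum_random x :
  fine (P [set w | x < partial_sum xi (tau w) w]) =
  \int[P]_w fine (P [set v | x < partial_sum xi (tau w) v]).
Proof.
congr fine.
apply: (prob_at_random_index tau_indep
  (E := fun n => [set v | x < partial_sum xi n v])).
by move=> n; exact: (walk_events_sigma_family n x).1.
Qed.

Lemma prob_running_max_random x :
  fine (P [set w | x < running_max xi (tau w) w]) =
  \int[P]_w fine (P [set v | x < running_max xi (tau w) v]).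
Proof.
congr fine.
apply: (prob_at_random_index tau_indep
  (E := fun n => [set v | x < running_max xi n v])).
by move=> n; exact: (walk_events_sigma_family n x).2.
Qed.

Lemma integrable_prob_at_tau (E : nat -> set T) : (forall n, measurable (E n)) ->
  P.-integrable setT (EFin \o (fun w => fine (P (E (tau w))))).
Proof.
move=> mE; apply: measurable_bounded_integrable => //.
- by rewrite (le_lt_trans (probability_le1 _ _))// ltry.
- exact: (measurable_comp_tau tau (fun n => fine (P (E n)))).
exists 1; split; first exact: num_real.
move=> M M1 w _; rewrite /= ger0_norm ?fine_ge0//.
apply: le_trans (ltW M1); rewrite -lee_fin fineK ?fin_num_measure//.
exact: probability_le1.
Qed.

(** The common shape of the functions of [tau] that bound the conditional
    probabilities: a main term, a correction for large values of [tau], and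
    the indicator of the values at which the drift alone reaches [x]. *)
Lemma integral_tau_bound (L c1 c2 c3 m : R) :
  P.-integrable setT (EFin \o (fun w => c1 * natr_rv tau w +
    (c2 * large_part (natr_rv tau) L w +
     c3 * \1_[set w | m < natr_rv tau w] w))) /\
  \int[P]_w (c1 * natr_rv tau w + (c2 * large_part (natr_rv tau) L w +
     c3 * \1_[set w | m < natr_rv tau w] w)) =
  c1 * A + (c2 * \int[P]_w large_part (natr_rv tau) L w +
     c3 * fine (P [set w | m < (tau w)%:R])).
Proof.
have iZ (f : T -> R) (c : R) : P.-integrable setT (EFin \o f) ->
    P.-integrable setT (EFin \o (fun w => c * f w)).
  by move=> /(integrableZl measurableT c); apply: eq_integrable.
have iD (f g : T -> R) : P.-integrable setT (EFin \o f) ->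
    P.-integrable setT (EFin \o g) ->
    P.-integrable setT (EFin \o (fun w => f w + g w)).
  by move=> h1 h2; have := integrableD measurableT h1 h2; apply: eq_integrable.
have mB := measurable_natr_rv_gt m.
have i2 := integrable_large_part tau_int L.
have i3 : P.-integrable setT (EFin \o \1_[set w | m < natr_rv tau w]).
  exact: integrable_indic.
have j1 := iZ _ c1 tau_int; have j2 := iZ _ c2 i2; have j3 := iZ _ c3 i3.
have j23 := iD _ _ j2 j3.
split; first exact: iD.
rewrite (RintegralD measurableT j1 j23) (RintegralD measurableT j2 j3).
rewrite (RintegralZl _ measurableT tau_int) (RintegralZl _ measurableT i2).
rewrite (RintegralZl _ measurableT i3).
by congr (_ + (_ + _ * _)); rewrite /Rintegral integral_indic// setIT.
Qed.

(** The level [L] is chosen so that the constant [C] of the intermediate range,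
    applied to the part of [tau] above [L], costs at most half of [e]. *)
Lemma random_max_upper (e : R) : 0 < e < 1 -> \forall x \near +oo,
  fine (P [set w | x < running_max xi (tau w) w]) <= (1 + e) * H x.
Proof.
move=> /andP[e0 e1].
have A0 := tau_mean_gt0.
have [r r01 hr] := irv_ratio tau_irv e0.
have [C C0 hC] := running_max_bound_below_drift xi_indep xi_distr intF meanF a0
  F_dom r01.
have [|L [L0 HL]] := integral_large_part_small tau_int (e := e / 2 * A / C).
  by rewrite divr_gt0// mulr_gt0// divr_gt0.
have hN : \forall x \near +oo, forall n, (n <= Num.truncn L)%N ->
    fine (P [set w | x < running_max xi n w]) <= (1 + e / 2) * (n%:R * tail F x).
  apply: near_forall_leq => n.
  apply: (running_max_fixed_upper xi_indep xi_distr intF) => //.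
  by rewrite divr_gt0.
near=> x.
have hCx : forall n, (0 < n)%N -> n%:R <= (1 - r) * (x / a) ->
    fine (P [set w | x < running_max xi n w]) <= C * (n%:R * tail F x).
  by near: x.
have hNx : forall n, (n <= Num.truncn L)%N ->
    fine (P [set w | x < running_max xi n w]) <= (1 + e / 2) * (n%:R * tail F x).
  by near: x.
have hrx : tail (distribution P (natr_rv tau)) ((1 - r) * (x / a)) <=
    (1 + e) * tail (distribution P (natr_rv tau)) (x / a).
  by near: x; exact: (near_pinfty_scale a0 hr).
rewrite !tail_natr_rv in hrx.
have t0 : 0 <= tail F x := tail_ge0 F x.
pose m := (1 - r) * (x / a).
have [ib Eb] := integral_tau_bound L ((1 + e / 2) * tail F x) (C * tail F x) 1 m.
rewrite prob_running_max_random.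
apply: (@le_trans _ _ (\int[P]_w ((1 + e / 2) * tail F x * natr_rv tau w +
    (C * tail F x * large_part (natr_rv tau) L w +
     1 * \1_[set w | m < natr_rv tau w] w)))).
  apply: le_Rintegral => //.
    apply: (integrable_prob_at_tau
      (E := fun n => [set v | x < running_max xi n v])).
    by move=> n; exact: measurable_running_max_gt.
  move=> w _; rewrite indic_gtE mul1r.
  have b1 : 0 <= (1 + e / 2) * tail F x * natr_rv tau w.
    by rewrite !mulr_ge0//; lra.
  have b2 : 0 <= C * tail F x * large_part (natr_rv tau) L w.
    by rewrite !mulr_ge0 ?large_part_ge0// ltW.
  have [mt|mt] := ltP m (natr_rv tau w).
    have : fine (P [set v | x < running_max xi (tau w) v]) <= 1.
      have mE := measurable_running_max_gt xi (tau w) x.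
      by rewrite -lee_fin fineK ?fin_num_measure// probability_le1.
    by rewrite /=; lra.
  rewrite /= addr0.
  have [tL|tL] := leP (natr_rv tau w) L.
    apply: (@le_trans _ _ ((1 + e / 2) * ((tau w)%:R * tail F x))).
      by apply: hNx; rewrite truncn_ge_nat// ltW.
    by move: b1; rewrite /natr_rv; lra.
  have lpE : large_part (natr_rv tau) L w = natr_rv tau w.
    by rewrite /large_part ger0_norm ?tL.
  rewrite lpE; have : fine (P [set v | x < running_max xi (tau w) v]) <=
      C * ((tau w)%:R * tail F x).
    apply: hCx => //; rewrite -(ltr0n R); exact: lt_trans tL.
  by move: b1; rewrite /natr_rv; lra.
rewrite Eb mul1r /H mulrDr; set pm := fine _ in hrx *.
have : C * tail F x * \int[P]_w large_part (natr_rv tau) L w <=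
    e / 2 * A * tail F x.
  rewrite [leRHS](_ : _ = C * tail F x * (e / 2 * A / C)).
    by rewrite ler_wpM2l// mulr_ge0// ltW.
  by field; rewrite gt_eqF.
by move: hrx; lra.
Unshelve. all: by end_near. Qed.

(** Here [m] is the number of steps beyond which the walk is above [x] with
    probability at least [1 - c].  Intermediate regular variation is used at
    [m], where it compares [m] with [(1 - r) * m = x / a]. *)
Lemma random_sum_lower (e : R) : 0 < e < 1 -> \forall x \near +oo,
  (1 - e) * H x <= fine (P [set w | x < partial_sum xi (tau w) w]).
Proof.
move=> /andP[e0 e1].
have A0 := tau_mean_gt0.
pose c := e / 2.
have c0 : 0 < c by rewrite divr_gt0.
have c1 : c < 1 by rewrite /c; lra.
have c01 : 0 < c < 1 by rewrite c0.
have [r r01 hr] := irv_ratio tau_irv c0.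
have r1 : 0 < 1 - r by move: r01 => /andP[]; lra.
have hC := partial_sum_lower_above_drift xi_indep xi_distr intF meanF a0 r01 c0.
have [|L [L0 HL]] := integral_large_part_small tau_int (e := c * A).
  by rewrite mulr_gt0.
have hN : \forall x \near +oo, forall n, (n <= Num.truncn L)%N ->
    (1 - c) * (n%:R * tail F x) <= fine (P [set w | x < partial_sum xi n w]).
  apply: near_forall_leq => n.
  exact: (partial_sum_fixed_lower xi_indep xi_distr intF).
have ar0 : 0 < a * (1 - r) by rewrite mulr_gt0.
near=> x.
have hCx : forall n, x / (a * (1 - r)) < n%:R ->
    1 - c <= fine (P [set w | x < partial_sum xi n w]).
  by near: x.
have hNx : forall n, (n <= Num.truncn L)%N ->
    (1 - c) * (n%:R * tail F x) <= fine (P [set w | x < partial_sum xi n w]).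
  by near: x.
have hrx : tail (distribution P (natr_rv tau)) ((1 - r) * (x / (a * (1 - r)))) <=
    (1 + c) * tail (distribution P (natr_rv tau)) (x / (a * (1 - r))).
  by near: x; exact: (near_pinfty_scale ar0 hr).
pose m := x / (a * (1 - r)); rewrite -/m in hrx.
rewrite !tail_natr_rv in hrx.
have Lm : L <= m.
  rewrite /m ler_pdivlMr//; near: x; apply: nbhs_pinfty_ge; exact: num_real.
have t0 : 0 <= tail F x := tail_ge0 F x.
have [ib Eb] := integral_tau_bound L ((1 - c) * tail F x) (- ((1 - c) * tail F x))
  (1 - c) m.
have mrE : (1 - r) * m = x / a.
  by rewrite /m; field; rewrite !gt_eqF.
rewrite prob_partial_sum_random.
apply: (@le_trans _ _ (\int[P]_w ((1 - c) * tail F x * natr_rv tau w +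
    (- ((1 - c) * tail F x) * large_part (natr_rv tau) L w +
     (1 - c) * \1_[set w | m < natr_rv tau w] w)))); last first.
  apply: le_Rintegral => //.
    apply: (integrable_prob_at_tau
      (E := fun n => [set v | x < partial_sum xi n v])).
    by move=> n; exact: measurable_partial_sum_gt.
  move=> w _; rewrite indic_gtE.
  have [tL|tL] := leP (natr_rv tau w) L.
    have -> : large_part (natr_rv tau) L w = 0.
      by rewrite /large_part ger0_norm// ltNge tL.
    rewrite ltNge (le_trans tL Lm) /= !mulr0 !addr0.
    apply: (@le_trans _ _ ((1 - c) * ((tau w)%:R * tail F x))).
      by rewrite /natr_rv; lra.
    by apply: hNx; rewrite truncn_ge_nat// ltW.
  have -> : large_part (natr_rv tau) L w = natr_rv tau w.
    by rewrite /large_part ger0_norm ?tL.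
  rewrite addrA mulNr subrr add0r.
  have [mt|mt] := ltP m (natr_rv tau w); last by rewrite mulr0 fine_ge0.
  by rewrite mulr1; exact: hCx.
rewrite Eb /H; rewrite mrE in hrx.
set p := fine _ in hrx *; set pm := fine (P [set w | m < _]) in hrx *.
have pm0 : 0 <= pm by rewrite fine_ge0.
have i0 : A * tail F x * (1 - c) <=
    A * tail F x - tail F x * \int[P]_w large_part (natr_rv tau) L w.
  have : tail F x * \int[P]_w large_part (natr_rv tau) L w <= tail F x * (c * A).
    by rewrite ler_wpM2l.
  lra.
have h1 : (1 - e) * p <= (1 - c) * pm.
  have : (1 - e) * p <= (1 - e) * ((1 + c) * pm) by rewrite ler_wpM2l//; lra.
  rewrite /c; have : 0 <= e ^+ 2 * pm by rewrite mulr_ge0// sqr_ge0.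
  lra.
have h2 : (1 - e) * (A * tail F x) <=
  (1 - c) * (A * tail F x - tail F x * \int[P]_w large_part (natr_rv tau) L w).
  apply: (@le_trans _ _ ((1 - c) * (A * tail F x * (1 - c)))).
    have : 0 <= e ^+ 2 * (A * tail F x).
      by rewrite mulr_ge0 ?sqr_ge0// mulr_ge0// ltW.
    rewrite /c; lra.
  by rewrite ler_wpM2l//; lra.
lra.
Unshelve. all: by end_near. Qed.

End RandomIndex.

Theorem theorem8 (R : realType) (d : measure_display) (T : measurableType d)
    (P : probability T R) (F : probability R R)
    (xi : nat -> {RV P >-> R}) (tau : {RV P >-> nat})
    (xi_indep : mutually_independent xi)
    (xi_distr : forall (n : nat) (A : set R), measurable A ->
       distribution P (xi n) A = F A)
    (xi_int : P.-integrable setT (EFin \o xi 0%N))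
    (xi_mean_gt0 : (0 < 'E_P[xi 0%N])%E)
    (tau_mean : ('E_P[natr_rv tau] < +oo)%E)
    (tau_indep : independent_of_family tau (fun n => xi n.+1))
    (tau_irv : intermediate_regularly_varying (distribution P (natr_rv tau)))
    (F_long : long_tailed F)
    (F_dom : dominated_varying F) :
  let PS := fun x : R => fine (P [set w | x < partial_sum xi (tau w) w]) in
  let PM := fun x : R => fine (P [set w | x < running_max xi (tau w) w]) in
  asymp_equiv PS PM /\
  asymp_equiv PM (fun x =>
    fine 'E_P[natr_rv tau] * tail F x
    + fine (P [set w | x / fine 'E_P[xi 0%N] < (tau w)%:R])).
Proof.
move=> PS PM.
have intF := law_integrable (xi_distr 0%N) xi_int.
have meanF := law_mean (xi_distr 0%N) xi_int.
have tau_int : P.-integrable setT (EFin \o natr_rv tau).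
  apply/integrableP; split.
    by apply/measurable_EFinP; exact: measurable_natr_rv.
  move: tau_mean; rewrite expectation_def; apply: le_lt_trans.
  rewrite le_eqVlt; apply/orP; left; apply/eqP; apply: eq_integral => w _.
  by rewrite /= ger0_norm// /natr_rv.
have aE : \int[P]_w xi 0%N w = fine 'E_P[xi 0%N] by rewrite expectation_def.
have AE : \int[P]_w natr_rv tau w = fine 'E_P[natr_rv tau].
  by rewrite expectation_def.
have a0 : 0 < fine 'E_P[xi 0%N].
  rewrite fine_gt0// xi_mean_gt0/= expectation_def.
  by have /fin_numPlt/andP[] := integrable_fin_num measurableT xi_int.
rewrite aE in meanF; rewrite -AE.
apply: asymp_equiv_sandwich.
- near=> x; rewrite ltr_wpDl//.
    rewrite mulr_ge0 ?tail_ge0// ltW//; exact: tau_mean_gt0.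
  rewrite -tail_natr_rv; have [G0 _] := tau_irv; exact: G0.
- move=> x; apply: fine_le_prob.
  + apply: (measurable_at_random_index tau
      (E := fun n => [set v | x < partial_sum xi n v])).
    by move=> n; exact: measurable_partial_sum_gt.
  + apply: (measurable_at_random_index tau
      (E := fun n => [set v | x < running_max xi n v])).
    by move=> n; exact: measurable_running_max_gt.
  + by move=> w /= /lt_le_trans; apply; exact: partial_sum_le_running_max.
- by move=> e e01; exact: random_sum_lower.
- by move=> e e01; exact: random_max_upper.
Unshelve. all: by end_near. Qed.
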